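(* The mu function for the chain of spaces $L_a$, $0<a<\infty$, is $$\mu^{\diamond}(a)=\mu(a)+a\frac{d}{da}\log\frac{p(a)-q(a)}{p(a)+q(a)}=2a+a\frac{d}{da}\log\frac{(2a-1)I_0^2(2a)-2a\,I_1^2(2a)+1}{(2a+1)I_0^2(2a)-2a\,I_1^2(2a)-1},$$ and $$\mu^{\diamond}(a)=2a-2+o(1)\qquad(a\to+\infty).$$ Here $\mu(a)=2a$, $p(a)=a(I_0^2(2a)-I_1^2(2a))$, $q(a)=\frac12(I_0^2(2a)-1)$.
   Context: $\mathcal H$ is the unitary self-reciprocal operator on $L^2(0,\infty;dx)$ with kernel $J_0(2\sqrt{xy})$, and $L_a$ is the Hilbert space of $f\in L^2(0,\infty;dx)$ such that $f$ and $\mathcal H(f)$ are both constant on $(0,a)$. Let $L$ be the unitary operator $L(f)(x)=f(x)-\frac1x\int_0^xf(y)\,dy$ on $L^2(0,\infty;dx)$ and $\mathcal H^{\diamond}=L\,\mathcal H\,L^{-1}$, which is self-adjoint and self-reciprocal, with kernel $k^{\diamond}(xy)=J_0(2\sqrt{xy})-2\frac{J_1(2\sqrt{xy})}{\sqrt{xy}}+\frac{1-J_0(2\sqrt{xy})}{xy}=\sum_{n\ge0}(-1)^n\frac{n^2x^ny^n}{(n+1)!^2}$. $L$ maps $L_a$ onto the space of square integrable functions vanishing on $(0,a)$ with $\mathcal H^{\diamond}$ transform vanishing on $(0,a)$. The mu function of the chain $(L_a)$ is the one attached to $\mathcal H^{\diamond}$: $\mu^{\diamond}(a)=a\phi_a^{\diamond+}(a)+a\phi_a^{\diamond-}(a)$,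 where $\phi_a^{\diamond\pm}$ are the solutions of $\phi_a^{\diamond\pm}(x)\pm\int_0^ak^{\diamond}(xy)\phi_a^{\diamond\pm}(y)\,dy=k^{\diamond}(ax)$; equivalently $\mu^{\diamond}(a)=a\frac{d}{da}\log\frac{\det(1+H_a^{\diamond})}{\det(1-H_a^{\diamond})}$ with $H_a^{\diamond}$ the integral operator on $L^2(0,a;dx)$ with kernel $k^{\diamond}(xy)$ (Fredholm determinants). $I_\nu$ are modified Bessel functions. *)

(* Defs.v *)
From Stdlib Require Import Arith Reals Lra Lia ClassicalEpsilon.
From Coquelicot Require Import Coquelicot.

Open Scope R_scope.

Definition BesselI (nu : nat) (z : R) : R :=
  (z / 2) ^ nu *
  PSeries (fun m => / (INR (fact m) * INR (fact (m + nu)))) ((z / 2) ^ 2).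

Definition BesselJ (nu : nat) (z : R) : R :=
  (z / 2) ^ nu *
  PSeries (fun m => (-1) ^ m / (INR (fact m) * INR (fact (m + nu)))) ((z / 2) ^ 2).

(** [k_diamond (x * y)] is the kernel of [L H L^-1] on [L^2(0,oo)], where [H] has
    kernel [J_0(2 sqrt(x y))] and [L f x = f x - (1/x) int_0^x f].  The power
    series is used because the closed form in Bessel functions (lemma
    [k_diamond_closed_form]) has a removable singularity at [0]. *)
Definition k_diamond (t : R) : R :=
  PSeries (fun n => (-1) ^ n * INR n ^ 2 / INR (fact (n + 1)) ^ 2) t.

(** [k_diamond] being entire, a square integrable solution on [(0,a)] of the
    integral equation is smooth, and the equation itself extends it to the
    whole line; hence the equation is imposed at every real [x]. *)
Definition is_phi_diamond (eps a : R) (f : R -> R) : Prop :=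
  (forall x, continuous f x) /\
  (forall x, f x + eps * RInt (fun y => k_diamond (x * y) * f y) 0 a
             = k_diamond (a * x)).

Definition phi_diamond (eps a : R) : R -> R :=
  epsilon (inhabits (fun _ : R => 0)) (is_phi_diamond eps a).

Definition mu_diamond (a : R) : R :=
  a * phi_diamond 1 a a + a * phi_diamond (-1) a a.

Definition mu (a : R) : R := 2 * a.

Definition p (a : R) : R := a * (BesselI 0 (2 * a) ^ 2 - BesselI 1 (2 * a) ^ 2).

Definition q (a : R) : R := / 2 * (BesselI 0 (2 * a) ^ 2 - 1).

Lemma ex_pseries_le_inv_fact (c : nat -> R) (x : R) :
  (forall n, Rabs (c n) <= / INR (fact n)) -> ex_pseries c x.
Proof.
intros H.
apply ex_pseries_R, (@ex_series_le R_AbsRing R_CompleteNormedModule) with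
  (b := fun n => Rabs x ^ n / INR (fact n)).
- intros n; change (Rabs (c n * x ^ n) <= Rabs x ^ n / INR (fact n)).
  rewrite Rabs_mult, <- RPow_abs, Rmult_comm.
  apply Rmult_le_compat_l; [apply pow_le, Rabs_pos | apply H].
- exists (exp (Rabs x)).
  apply is_series_ext with (2 := is_exp_Reals (Rabs x)).
  intros n; rewrite pow_n_pow; reflexivity.
Qed.

Lemma bound_coef (m k : nat) :
  Rabs ((-1) ^ m / (INR (fact m) * INR (fact k))) <= / INR (fact m).
Proof.
pose proof (INR_fact_lt_0 m); pose proof (INR_fact_lt_0 k).
assert (1 <= INR (fact k)) by (apply (le_INR 1), lt_O_fact).
unfold Rdiv; rewrite Rabs_mult, pow_1_abs, Rmult_1_l, Rabs_pos_eq.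
- apply Rinv_le_contravar; nra.
- left; apply Rinv_0_lt_compat; nra.
Qed.

Lemma k_diamond_closed_form (t : R) : 0 < t ->
  k_diamond t =
    BesselJ 0 (2 * sqrt t) - 2 * (BesselJ 1 (2 * sqrt t) / sqrt t)
    + (1 - BesselJ 0 (2 * sqrt t)) / t.
Proof.
intros Ht.
assert (Hs : sqrt t <> 0) by (apply Rgt_not_eq, sqrt_lt_R0, Ht).
unfold BesselJ.
replace (2 * sqrt t / 2) with (sqrt t) by field.
rewrite pow2_sqrt by lra.
set (c0 := fun m => (-1) ^ m / (INR (fact m) * INR (fact (m + 0)))).
set (c1 := fun m => (-1) ^ m / (INR (fact m) * INR (fact (m + 1)))).
assert (E0 : ex_pseries c0 t) by (apply ex_pseries_le_inv_fact; intro; apply bound_coef).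
assert (E1 : ex_pseries c1 t) by (apply ex_pseries_le_inv_fact; intro; apply bound_coef).
assert (Ed : ex_pseries (PS_decr_1 c0) t).
{ apply ex_pseries_le_inv_fact; intro n; unfold PS_decr_1, c0.
  eapply Rle_trans; [apply bound_coef |].
  apply Rinv_le_contravar; [apply INR_fact_lt_0 |].
  apply le_INR, fact_le; lia. }
assert (D : PSeries c0 t = 1 + t * PSeries (PS_decr_1 c0) t).
{ rewrite (PSeries_decr_1 c0 t E0); f_equal.
  unfold c0; simpl; field. }
replace ((1 - sqrt t ^ 0 * PSeries c0 t) / t) with (- PSeries (PS_decr_1 c0) t)
  by (rewrite D; simpl; field; lra).
replace (sqrt t ^ 1 * PSeries c1 t / sqrt t) with (PSeries c1 t)
  by (field; exact Hs).
rewrite pow_O, Rmult_1_l.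
unfold k_diamond.
rewrite (PSeries_ext _
  (PS_plus (PS_minus c0 (PS_scal 2 c1)) (PS_opp (PS_decr_1 c0)))).
- rewrite PSeries_plus, PSeries_minus, PSeries_opp, PSeries_scal.
  + reflexivity.
  + exact E0.
  + apply ex_pseries_scal; [apply Rmult_comm | exact E1].
  + apply ex_pseries_minus; [exact E0 |].
    apply ex_pseries_scal; [apply Rmult_comm | exact E1].
  + apply ex_pseries_opp, Ed.
- intro n.
  change ((-1) ^ n * INR n ^ 2 / INR (fact (n + 1)) ^ 2
          = c0 n - 2 * c1 n + - c0 (S n)).
  unfold c0, c1.
  rewrite !Nat.add_0_r, !Nat.add_1_r, fact_simpl, mult_INR, S_INR.
  pose proof (pos_INR n); pose proof (INR_fact_lt_0 n).
  simpl pow; field; lra.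
Qed.

(* Main.v *)
Require Import Defs.
From Stdlib Require Import Arith Reals Lra Lia ClassicalEpsilon.
From Coquelicot Require Import Coquelicot.

Open Scope R_scope.

(** The plan is to exhibit the two solutions of the integral equation in closed
    form, to show that they are the only ones, and to read off their values at
    [a].

    Existence.  Let [H_a] be the operator on [(0,a)] with kernel
    [J_0 (2 sqrt (x y))].  In terms of [I_n = I_n (2 a)], the entire function
    [u(x) = sum I_n (-x)^n / n!], which is [I_0 (2 sqrt (a (a - x)))], satisfies
    [H_a u + u' = 0] and [H_a u' + u = J_0 (2 sqrt (a x))]; these are statements on
    the moments of [u] ([moments_u_u']), and both the moments and the Taylor
    coefficients obey the recurrence of the [I_n].  The kernel [k_diamond] arises
    from [J_0] by conjugation with [L], which on [(0,a)] means: if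
    [psi + eps H_a psi = J_0 (2 sqrt (a x)) + constant] and [psi] has the integral
    [eps] over [(0,a)], then [L psi] is the wanted solution.  The function
    [u + eps u'] has the first property, and the second one is achieved by adding
    a multiple of [s + eps d], a solution of the equation with constant right-hand
    side.  The integrals of [s] and [d] over [(0,a)] are [p] and [- q]
    ([moment_s], [moment_d_0]); this is how [p - eps q] enters as a denominator.

    Uniqueness.  If [f] solves the homogeneous equation on [(0,a)], pairing it
    with the known solution on [(0,b)], [b <= a], and using the symmetry of the
    kernel turns the equation into a Volterra equation for [f], so [f = 0]
    ([null_solution_zero]).

    Evaluation.  At [x = a] the solution is
    [1 - eps a - eps / a + eps (I_0 - eps I_1)^2 / (p - eps q)], and
    [(I_0 - eps I_1)^2] is exactly the derivative of [p - eps q]; adding the two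
    signs gives the logarithmic derivative ([mu_diamond_log_derivative]).

    Asymptotics.  From the differential system for [I_0] and [I_1],
    [I_0 / (I_0 - I_1) = 4 a - 1/2 + O(1/a)] ([bI_ratio_asymptotics]).  It gives
    the logarithmic derivatives of [(p -+ q)'], multiplied by [a], as
    [4 a - 3 + o(1)] and [4 a - 1 + o(1)]; by [log_derivative_asymptotics] these
    pass to [p -+ q], whence the constant [-3 + 1 = -2]. *)

(* The equalities produced by [RInt] and [is_series] live in a structure whose
   carrier is only convertible to [R]. *)
Ltac ring_R := match goal with |- @eq _ ?x ?y => change (@eq R x y); ring end.

(** * Entire power series *)

(** Every series below is entire of order at most one; this explicit form of
    the decay passes through sums, term-by-term derivatives and averages, and
    it bounds values uniformly in parameters. *)
Definition fact_decay (C : R) (c : nat -> R) : Prop :=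
  forall n, Rabs (c n) <= C / INR (fact n).

Lemma fact_ge_1 n : 1 <= INR (fact n).
Proof. apply (le_INR 1), lt_O_fact. Qed.

Lemma inv_fact_bounds n : 0 < / INR (fact n) <= 1.
Proof.
pose proof (fact_ge_1 n); split.
- apply Rinv_0_lt_compat; lra.
- rewrite <- Rinv_1; apply Rinv_le_contravar; lra.
Qed.

Lemma fact_decay_const_ge_0 C c : fact_decay C c -> 0 <= C.
Proof.
intros H; specialize (H 0%nat); simpl in H.
pose proof (Rabs_pos (c 0%nat)); lra.
Qed.

Lemma Series_ge_0 (f : nat -> R) : (forall n, 0 <= f n) -> ex_series f -> 0 <= Series f.
Proof.
intros Hf E; rewrite <- (Rmult_0_l (Series f)), <- Series_scal_l.
apply Series_le; [intros n; rewrite Rmult_0_l; split; [lra | apply Hf] | exact E].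
Qed.

Lemma is_series_exp x : is_series (fun n => x ^ n / INR (fact n)) (exp x).
Proof.
generalize (is_exp_Reals x); intros H; apply is_pseries_R in H.
revert H; apply is_series_ext; intros n; apply Rmult_comm.
Qed.

Lemma pow_div_fact_le_exp (x : R) n : 0 <= x -> x ^ n / INR (fact n) <= exp x.
Proof.
intros Hx.
rewrite <- (is_series_unique _ _ (is_series_exp x)).
assert (Hpos : forall k, 0 <= x ^ k / INR (fact k)).
{ intros k; apply Rmult_le_pos; [apply pow_le, Hx | apply Rlt_le, inv_fact_bounds]. }
rewrite (Series_incr_n _ (S n)); [| lia | exists (exp x); apply is_series_exp].
simpl Init.Nat.pred.
assert (0 <= Series (fun k => x ^ (S n + k) / INR (fact (S n + k)))).
{ apply Series_ge_0; [intros k; apply Hpos |].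
  apply (ex_series_incr_n (fun k => x ^ k / INR (fact k)) (S n)).
  exists (exp x); apply is_series_exp. }
assert (x ^ n / INR (fact n) <= sum_f_R0 (fun k => x ^ k / INR (fact k)) n).
{ destruct n as [|n]; [simpl; lra |].
  rewrite tech5.
  assert (0 <= sum_f_R0 (fun k => x ^ k / INR (fact k)) n)
    by (apply cond_pos_sum; exact Hpos).
  lra. }
lra.
Qed.

Lemma ex_series_dominated (f g : nat -> R) :
  (forall n, Rabs (f n) <= g n) -> ex_series g -> ex_series f.
Proof.
intros H; apply (@ex_series_le R_AbsRing R_CompleteNormedModule); exact H.
Qed.

Lemma fact_decay_term C c x n : fact_decay C c ->
  Rabs (c n * x ^ n) <= C * (Rabs x ^ n / INR (fact n)).
Proof.
intros H; rewrite Rabs_mult, <- RPow_abs.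
replace (C * (Rabs x ^ n / INR (fact n))) with (C / INR (fact n) * Rabs x ^ n)
  by (unfold Rdiv; ring).
apply Rmult_le_compat_r; [apply pow_le, Rabs_pos | apply H].
Qed.

Lemma ex_series_exp_scal C x : ex_series (fun n => C * (x ^ n / INR (fact n))).
Proof.
apply (ex_series_scal_l (V := R_NormedModule) C); exists (exp x); apply is_series_exp.
Qed.

Lemma fact_decay_ex_series C c x : fact_decay C c -> ex_series (fun n => c n * x ^ n).
Proof.
intros H; eapply ex_series_dominated; [intros n; apply fact_decay_term, H |].
apply ex_series_exp_scal.
Qed.

Lemma fact_decay_ex_pseries C c x : fact_decay C c -> ex_pseries c x.
Proof. intros H; apply ex_pseries_R; eapply fact_decay_ex_series, H. Qed.

Lemma PSeries_abs_le C c x : fact_decay C c -> Rabs (PSeries c x) <= C * exp (Rabs x).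
Proof.
intros H; unfold PSeries.
eapply Rle_trans; [apply Series_Rabs |].
- eapply ex_series_dominated; [| apply (ex_series_exp_scal C (Rabs x))].
  intros n; rewrite Rabs_Rabsolu; apply fact_decay_term, H.
- rewrite <- (is_series_unique _ _ (is_series_exp (Rabs x))), <- Series_scal_l.
  apply Series_le; [| apply ex_series_exp_scal].
  intros n; split; [apply Rabs_pos | apply fact_decay_term, H].
Qed.

Lemma fact_decay_radius C c x : fact_decay C c -> Rbar_lt (Rabs x) (CV_radius c).
Proof.
intros H; apply Rbar_not_le_lt; intros Hle.
apply (CV_disk_outside c (Rabs x + 1)).
- eapply Rbar_le_lt_trans; [exact Hle |].
  simpl; pose proof (Rabs_pos x); rewrite (Rabs_pos_eq (Rabs x + 1)); lra.
- apply ex_series_lim_0; eapply fact_decay_ex_series, H.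
Qed.

Lemma PSeries_derive C c x : fact_decay C c ->
  is_derive (PSeries c) x (PSeries (PS_derive c) x).
Proof. intros H; eapply is_derive_PSeries, fact_decay_radius, H. Qed.

Lemma PSeries_continuous C c x : fact_decay C c -> continuous (PSeries c) x.
Proof.
intros H; apply (ex_derive_continuous (V := R_NormedModule)).
eexists; eapply PSeries_derive, H.
Qed.

Lemma fact_decay_ext C c c' : (forall n, c n = c' n) -> fact_decay C c -> fact_decay C c'.
Proof. intros E H n; rewrite <- E; apply H. Qed.

Lemma fact_decay_derive C c : fact_decay C c -> fact_decay C (PS_derive c).
Proof.
intros H n; unfold PS_derive.
rewrite Rabs_mult, Rabs_pos_eq by apply pos_INR.
eapply Rle_trans; [apply Rmult_le_compat_l; [apply pos_INR | apply H] |].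
rewrite fact_simpl, mult_INR.
right; field; split; [apply INR_fact_neq_0 | apply not_0_INR; lia].
Qed.

Lemma fact_decay_plus C D c d : fact_decay C c -> fact_decay D d ->
  fact_decay (C + D) (fun n => c n + d n).
Proof.
intros Hc Hd n; eapply Rle_trans; [apply Rabs_triang |].
unfold Rdiv; rewrite Rmult_plus_distr_r; apply Rplus_le_compat; [apply Hc | apply Hd].
Qed.

Lemma fact_decay_mult C (m c : nat -> R) M : fact_decay C c ->
  (forall n, Rabs (m n) <= M) -> fact_decay (M * C) (fun n => m n * c n).
Proof.
intros Hc Hm n; rewrite Rabs_mult; unfold Rdiv; rewrite Rmult_assoc.
apply Rmult_le_compat; try apply Rabs_pos; [apply Hm | apply Hc].
Qed.

Lemma fact_decay_scal C c k : fact_decay C c -> fact_decay (Rabs k * C) (fun n => k * c n).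
Proof.
intros H; apply (fact_decay_mult C (fun _ => k) c (Rabs k)); [exact H |].
intros; apply Rle_refl.
Qed.

Lemma PSeries_lin C D c d k l x : fact_decay C c -> fact_decay D d ->
  PSeries (fun n => k * c n + l * d n) x = k * PSeries c x + l * PSeries d x.
Proof.
intros Hc Hd.
change (PSeries (PS_plus (PS_scal k c) (PS_scal l d)) x = k * PSeries c x + l * PSeries d x).
rewrite PSeries_plus, !PSeries_scal; [reflexivity | |].
- eapply (fact_decay_ex_pseries _ (fun n => k * c n)), fact_decay_scal, Hc.
- eapply (fact_decay_ex_pseries _ (fun n => l * d n)), fact_decay_scal, Hd.
Qed.

Lemma PSeries_at_0 c : PSeries c 0 = c 0%nat.
Proof. apply PSeries_0. Qed.

Lemma PSeries_shift c d x : d 0%nat = 0 -> (forall n, d (S n) = c n) ->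
  PSeries d x = x * PSeries c x.
Proof.
intros H0 HS; rewrite <- PSeries_incr_1; apply PSeries_ext.
intros [|n]; simpl; [exact H0 | apply HS].
Qed.

Lemma PSeries_ge_first_two C c x : fact_decay C c -> (forall n, 0 <= c n) -> 0 <= x ->
  c 0%nat + x * c 1%nat <= PSeries c x.
Proof.
intros H Hc Hx.
assert (Hpos : forall d : nat -> R, (forall n, 0 <= d n) -> ex_pseries d x -> 0 <= PSeries d x).
{ intros d Hd Ed; apply Series_ge_0; [| apply ex_pseries_R, Ed].
  intros n; apply Rmult_le_pos; [apply Hd | apply pow_le, Hx]. }
pose proof (fact_decay_ex_pseries _ _ x H) as E.
assert (Hsh : forall d : nat -> R, ex_pseries d x -> (x = 0 \/ ex_pseries (PS_decr_1 d) x)).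
{ intros d Ed; destruct (Req_dec x 0) as [|Hne]; [left; assumption | right].
  apply ex_pseries_R in Ed; apply ex_pseries_R.
  apply (ex_series_incr_1 (fun n => d n * x ^ n)) in Ed.
  apply (ex_series_scal_l (V := R_NormedModule) (/ x)) in Ed.
  revert Ed; apply ex_series_ext; intros n; unfold PS_decr_1; simpl.
  change (/ x * (d (S n) * (x * x ^ n)) = d (S n) * x ^ n); field; exact Hne. }
destruct (Hsh c E) as [->|E1]; [rewrite PSeries_at_0; lra |].
destruct (Hsh _ E1) as [->|E2]; [rewrite PSeries_at_0; lra |].
rewrite (PSeries_decr_1 c x E), (PSeries_decr_1 _ x E1).
assert (0 <= PSeries (PS_decr_1 (PS_decr_1 c)) x)
  by (apply Hpos; [intros n; apply Hc | exact E2]).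
unfold PS_decr_1 at 1.
pose proof (Rmult_le_pos _ _ Hx (Rmult_le_pos _ _ Hx H0)).
lra.
Qed.

Lemma fact_decay_lin C D c d k l : fact_decay C c -> fact_decay D d ->
  fact_decay (Rabs k * C + Rabs l * D) (fun n => k * c n + l * d n).
Proof.
intros Hc Hd; apply fact_decay_plus; apply fact_decay_scal; assumption.
Qed.

Lemma is_series_PSeries C c x : fact_decay C c -> is_series (fun n => c n * x ^ n) (PSeries c x).
Proof. intros H; apply (Series_correct (fun n => c n * x ^ n)); eapply fact_decay_ex_series, H. Qed.

Lemma is_series_euler C c x : fact_decay C c ->
  is_series (fun n => INR n * c n * x ^ n) (x * PSeries (PS_derive c) x).
Proof.
intros H.
pose proof (PSeries_correct _ x (fact_decay_ex_pseries _ _ x (fact_decay_derive _ _ H))) as S.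
apply is_pseries_incr_1, is_pseries_R in S.
revert S; apply is_series_ext; intros [|n]; [change (0 * 1 = 0 * c 0%nat * 1); ring | reflexivity].
Qed.

Lemma PSeries_euler C c x : fact_decay C c ->
  x * PSeries (PS_derive c) x = PSeries (fun n => INR n * c n) x.
Proof. intros H; symmetry; eapply is_series_unique, is_series_euler, H. Qed.

Lemma derive_zero_const (f : R -> R) x y : (forall t, is_derive f t 0) -> f x = f y.
Proof.
intros H; destruct (Rtotal_order x y) as [Hxy|[->|Hxy]]; [| reflexivity | symmetry];
  apply (eq_is_derive (V := R_NormedModule) f); trivial; intros t _; apply H.
Qed.

Lemma increasing_le (f df : R -> R) a b : a <= b ->
  (forall x, a <= x <= b -> is_derive f x (df x)) ->
  (forall x, a <= x <= b -> 0 <= df x) -> f a <= f b.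
Proof.
intros Hab Hf Hdf.
destruct (MVT_gen f a b df) as [c [Hc E]];
  rewrite ?Rmin_left, ?Rmax_right in * by lra.
- intros x Hx; apply Hf; lra.
- intros x Hx; apply continuity_pt_filterlim.
  apply (ex_derive_continuous (V := R_NormedModule) f).
  eexists; apply Hf, Hx.
- specialize (Hdf c Hc); nra.
Qed.

(** * Integrals of continuous functions and of entire series *)

Lemma ex_RInt_cont (f : R -> R) a b : (forall x, continuous f x) -> ex_RInt f a b.
Proof. intros H; apply (ex_RInt_continuous (V := R_CompleteNormedModule)); intros; apply H. Qed.

Lemma RInt_ext_R (f g : R -> R) a b : (forall x, f x = g x) -> RInt f a b = RInt g a b.
Proof. intros H; apply RInt_ext; intros x _; apply H. Qed.

Lemma RInt_lin (f g : R -> R) k l a b :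
  (forall x, continuous f x) -> (forall x, continuous g x) ->
  RInt (fun x => k * f x + l * g x) a b = k * RInt f a b + l * RInt g a b.
Proof.
intros Hf Hg; apply is_RInt_unique.
apply (is_RInt_plus (V := R_NormedModule) (fun x => k * f x) (fun x => l * g x));
  apply (is_RInt_scal (V := R_NormedModule)), (RInt_correct (V := R_CompleteNormedModule)),
    ex_RInt_cont; assumption.
Qed.

Lemma RInt_of_derive (F f : R -> R) a b :
  (forall x, is_derive F x (f x)) -> (forall x, continuous f x) ->
  RInt f a b = F b - F a.
Proof.
intros HF Hf; apply is_RInt_unique.
apply (is_RInt_derive (V := R_CompleteNormedModule) F f); intros; [apply HF | apply Hf].
Qed.

Lemma continuous_mult_R (f g : R -> R) x :
  continuous f x -> continuous g x -> continuous (fun y => f y * g y) x.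
Proof. apply (continuous_mult (K := R_AbsRing)). Qed.

Lemma continuous_pow n x : continuous (fun y : R => y ^ n) x.
Proof.
apply (ex_derive_continuous (V := R_NormedModule)); auto_derive; trivial.
Qed.

Definition moment (f : R -> R) (a : R) (n : nat) : R := RInt (fun y => y ^ n * f y) 0 a.

Lemma moment_0 f a : moment f a 0 = RInt f 0 a.
Proof. unfold moment; apply RInt_ext_R; intros x; simpl; ring. Qed.

Lemma moment_lin f g k l a n :
  (forall x, continuous f x) -> (forall x, continuous g x) ->
  moment (fun x => k * f x + l * g x) a n = k * moment f a n + l * moment g a n.
Proof.
intros Hf Hg; unfold moment; rewrite <- RInt_lin.
- apply RInt_ext_R; intros x; ring.
- intros x; apply continuous_mult_R; [apply continuous_pow | apply Hf].
- intros x; apply continuous_mult_R; [apply continuous_pow | apply Hg].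
Qed.

Lemma moment_by_parts F f a n :
  (forall x, is_derive F x (f x)) -> (forall x, continuous f x) ->
  moment f a (S n) = a ^ S n * F a - INR (S n) * moment F a n.
Proof.
intros HF Hf.
assert (CF : forall x, continuous F x)
  by (intros x; apply (ex_derive_continuous (V := R_NormedModule) F); eexists; apply HF).
assert (H : RInt (fun x => 1 * (x ^ S n * f x) + INR (S n) * (x ^ n * F x)) 0 a
            = a ^ S n * F a - 0 ^ S n * F 0).
{ apply (RInt_of_derive (fun x => x ^ S n * F x)).
  - intros x.
    evar_last.
    { apply (is_derive_mult (fun x => x ^ S n) F); [| apply HF | exact Rmult_comm].
      apply is_derive_pow, (is_derive_id (K := R_AbsRing)). }
    unfold plus, mult, one; simpl Init.Nat.pred; simpl; ring.
  - intros x; apply (continuous_plus (V := R_NormedModule)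
      (fun x => 1 * (x ^ S n * f x)) (fun x => INR (S n) * (x ^ n * F x)));
      repeat apply continuous_mult_R; auto using continuous_pow, continuous_const, continuous_id. }
rewrite RInt_lin in H.
- unfold moment; rewrite pow_ne_zero in H by discriminate; lra.
- intros x; apply continuous_mult_R; [apply continuous_pow | apply Hf].
- intros x; apply continuous_mult_R; [apply continuous_pow | apply CF].
Qed.

Lemma continuous_lin (f g : R -> R) k l x :
  continuous f x -> continuous g x -> continuous (fun y => k * f y + l * g y) x.
Proof.
intros Hf Hg; apply (continuous_plus (V := R_NormedModule) (fun y => k * f y) (fun y => l * g y));
  apply continuous_mult_R; auto using continuous_const.
Qed.

Lemma continuous_bounded_on (f : R -> R) a b : a <= b -> (forall x, continuous f x) ->
  exists M, forall y, a <= y <= b -> Rabs (f y) <= M.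
Proof.
intros Hab Hf.
destruct (continuity_ab_maj (fun y => Rabs (f y)) a b Hab) as [m [Hm _]].
- intros c _; apply continuity_pt_filterlim.
  apply (continuous_comp f Rabs); [apply Hf | apply continuous_Rabs].
- exists (Rabs (f m)); exact Hm.
Qed.

Lemma abs_RInt_le_open (f : R -> R) a M : 0 <= a -> (forall x, continuous f x) ->
  (forall y, 0 < y < a -> Rabs (f y) <= M) -> Rabs (RInt f 0 a) <= a * M.
Proof.
intros Ha Hf HM.
eapply Rle_trans; [apply abs_RInt_le; [exact Ha | apply ex_RInt_cont, Hf] |].
replace (a * M) with (RInt (fun _ => M) 0 a)
  by (rewrite RInt_const; unfold scal; simpl; unfold mult; simpl; ring_R).
apply RInt_le; [exact Ha | | apply ex_RInt_cont; auto using continuous_const | exact HM].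
apply (ex_RInt_cont (fun y => Rabs (f y))); intros x.
apply (continuous_comp f Rabs); [apply Hf | apply continuous_Rabs].
Qed.

Lemma continuous_sum_n (g : nat -> R -> R) x N :
  (forall n, continuous (g n) x) -> continuous (fun y => sum_n (fun n => g n y) N) x.
Proof.
intros Hg; induction N as [|N IH].
- apply (continuous_ext (g 0%nat)); [intros y; rewrite sum_O; reflexivity | apply Hg].
- apply (continuous_ext (fun y => sum_n (fun n => g n y) N + g (S N) y)).
  + intros y; rewrite sum_Sn; reflexivity.
  + apply (continuous_plus (V := R_NormedModule)); [exact IH | apply Hg].
Qed.

Lemma RInt_sub (f g : R -> R) a b : (forall x, continuous f x) -> (forall x, continuous g x) ->
  RInt (fun x => 1 * f x + (-1) * g x) a b = RInt f a b - RInt g a b.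
Proof. intros Hf Hg; rewrite RInt_lin by assumption; ring_R. Qed.

Lemma RInt_sum_n (g : nat -> R -> R) a b N : (forall n x, continuous (g n) x) ->
  RInt (fun y => sum_n (fun n => g n y) N) a b = sum_n (fun n => RInt (g n) a b) N.
Proof.
intros Hg; induction N as [|N IH].
- rewrite sum_O; apply RInt_ext_R; intros x; rewrite sum_O; reflexivity.
- rewrite sum_Sn, <- IH.
  rewrite (RInt_ext_R _ (fun y => 1 * sum_n (fun n => g n y) N + 1 * g (S N) y)).
  + rewrite RInt_lin; [rewrite !Rmult_1_l; reflexivity | | apply Hg].
    intros x; apply continuous_sum_n; intros n; apply Hg.
  + intros x; rewrite sum_Sn, !Rmult_1_l; reflexivity.
Qed.

Lemma series_tail_le (f C : nat -> R) l N : (forall n, Rabs (f n) <= C n) -> ex_series C ->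
  is_series f l -> Rabs (l - sum_n f N) <= Series C - sum_n C N.
Proof.
intros Hf EC Hl.
assert (Ef : ex_series f) by (exists l; exact Hl).
rewrite <- (is_series_unique _ _ Hl), !sum_n_Reals.
rewrite (Series_incr_n f (S N)), (Series_incr_n C (S N)); try lia; try assumption.
simpl Init.Nat.pred.
replace (sum_f_R0 f N + Series (fun k => f (S N + k)%nat) - sum_f_R0 f N)
  with (Series (fun k => f (S N + k)%nat)) by ring.
replace (sum_f_R0 C N + Series (fun k => C (S N + k)%nat) - sum_f_R0 C N)
  with (Series (fun k => C (S N + k)%nat)) by ring.
apply (ex_series_incr_n C (S N)) in EC.
eapply Rle_trans; [apply Series_Rabs | apply Series_le].
- eapply ex_series_dominated; [| exact EC]; intros n; rewrite Rabs_Rabsolu; apply Hf.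
- intros n; split; [apply Rabs_pos | apply Hf].
- exact EC.
Qed.

(** Normal convergence on the open interval is enough, so that the summands may
    be known only away from a removable singularity at an end point. *)
Lemma is_series_RInt (g : nat -> R -> R) (f : R -> R) (C : nat -> R) a : 0 <= a ->
  (forall n x, continuous (g n) x) -> (forall x, continuous f x) ->
  (forall n y, 0 < y < a -> Rabs (g n y) <= C n) -> ex_series C ->
  (forall y, 0 < y < a -> is_series (fun n => g n y) (f y)) ->
  is_series (fun n => RInt (g n) 0 a) (RInt f 0 a).
Proof.
intros Ha Hg Hf HC EC Hs.
assert (Hle : forall N, Rabs (sum_n (fun n => RInt (g n) 0 a) N - RInt f 0 a)
                        <= a * (Series C - sum_n C N)).
{ intros N; rewrite <- RInt_sum_n by exact Hg.
  assert (CS : forall x, continuous (fun y => sum_n (fun n => g n y) N) x)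
    by (intros x; apply continuous_sum_n; intros n; apply Hg).
  replace (RInt (fun y => sum_n (fun n => g n y) N) 0 a - RInt f 0 a)
    with (RInt (fun y => 1 * sum_n (fun n => g n y) N + (-1) * f y) 0 a)
    by (apply RInt_sub; [exact CS | exact Hf]).
  apply abs_RInt_le_open; [exact Ha | intros x; apply continuous_lin; auto |].
  intros y Hy.
  replace (1 * sum_n (fun n => g n y) N + -1 * f y)
    with (- (f y - sum_n (fun n => g n y) N)) by ring.
  rewrite Rabs_Ropp; apply series_tail_le; auto. }
assert (Ht : is_lim_seq (fun N => a * (Series C - sum_n C N)) 0).
{ evar_last.
  - apply (is_lim_seq_scal_l _ a), is_lim_seq_minus';
      [apply is_lim_seq_const | apply (Series_correct C EC)].
  - simpl; f_equal; ring. }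
assert (H0 : is_lim_seq (fun N => sum_n (fun n => RInt (g n) 0 a) N - RInt f 0 a) 0).
{ apply is_lim_seq_abs_0; eapply is_lim_seq_le_le; [| apply is_lim_seq_const | exact Ht].
  intros N; split; [apply Rabs_pos | apply Hle]. }
assert (H1 : is_lim_seq (sum_n (fun n => RInt (g n) 0 a)) (0 + RInt f 0 a)).
{ eapply is_lim_seq_ext; [| apply is_lim_seq_plus'; [exact H0 | apply is_lim_seq_const]].
  intros N; simpl; unfold Rminus; rewrite Rplus_assoc, Rplus_opp_l; apply Rplus_0_r. }
rewrite Rplus_0_l in H1; exact H1.
Qed.

Lemma moment_abs_le f a M n : 0 <= a -> (forall x, continuous f x) ->
  (forall y, 0 <= y <= a -> Rabs (f y) <= M) -> Rabs (moment f a n) <= a * (a ^ n * M).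
Proof.
intros Ha Hf HM; apply abs_RInt_le_open; [exact Ha | |].
- intros x; apply continuous_mult_R; [apply continuous_pow | apply Hf].
- intros y Hy; rewrite Rabs_mult; apply Rmult_le_compat; try apply Rabs_pos.
  + rewrite <- RPow_abs; apply pow_incr; rewrite Rabs_pos_eq; lra.
  + apply HM; lra.
Qed.

Lemma is_series_moments D e f a : 0 <= a -> fact_decay D e -> (forall x, continuous f x) ->
  is_series (fun n => e n * moment f a n) (RInt (fun y => f y * PSeries e y) 0 a).
Proof.
intros Ha He Hf.
destruct (continuous_bounded_on f 0 a Ha Hf) as [M HM].
apply is_series_ext with (fun n => RInt (fun y => e n * (y ^ n * f y) + 0 * 0) 0 a).
{ intros n; rewrite (RInt_lin (fun y => y ^ n * f y) (fun _ => 0)).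
  - unfold moment; rewrite Rmult_0_l; apply Rplus_0_r.
  - intros x; apply continuous_mult_R; [apply continuous_pow | apply Hf].
  - intros; apply continuous_const. }
apply is_series_RInt with (fun n => M * (D * (a ^ n / INR (fact n)))); [exact Ha | | | | |].
- intros n x; apply (continuous_lin (fun y => y ^ n * f y) (fun _ => 0));
    [apply continuous_mult_R; auto using continuous_pow | apply continuous_const].
- intros x; apply continuous_mult_R; [apply Hf | eapply PSeries_continuous, He].
- intros n y Hy.
  replace (e n * (y ^ n * f y) + 0 * 0) with (f y * (e n * y ^ n)) by ring.
  rewrite Rabs_mult; apply Rmult_le_compat; try apply Rabs_pos; [apply HM; lra |].
  eapply Rle_trans; [apply fact_decay_term, He |].
  apply Rmult_le_compat_l; [eapply fact_decay_const_ge_0, He |].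
  apply Rmult_le_compat_r; [apply Rlt_le, inv_fact_bounds |].
  apply pow_incr; rewrite Rabs_pos_eq; lra.
- apply (ex_series_scal_l (V := R_NormedModule) M), ex_series_exp_scal.
- intros y _.
  apply is_series_ext with (fun n => f y * (e n * y ^ n)); [intros n; simpl; ring_R |].
  apply (is_series_scal_l (V := R_NormedModule) (f y)).
  apply (Series_correct (fun n => e n * y ^ n)); eapply fact_decay_ex_series, He.
Qed.

(** * The kernel and uniqueness of the solutions *)

Definition k_coef (n : nat) : R := (-1) ^ n * INR n ^ 2 / INR (fact (n + 1)) ^ 2.

Lemma k_coef_abs_le n : Rabs (k_coef n) <= / INR (fact n) * / INR (fact n).
Proof.
unfold k_coef; rewrite Nat.add_1_r, fact_simpl, mult_INR, S_INR.
pose proof (INR_fact_lt_0 n); pose proof (pos_INR n).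
replace ((-1) ^ n * INR n ^ 2 / ((INR n + 1) * INR (fact n)) ^ 2)
  with ((-1) ^ n * ((INR n / (INR n + 1)) ^ 2 * (/ INR (fact n) * / INR (fact n))))
  by (field; lra).
rewrite Rabs_mult, pow_1_abs, Rmult_1_l.
pose proof (inv_fact_bounds n).
assert (0 <= INR n / (INR n + 1) <= 1).
{ split; [apply Rmult_le_pos; [lra | apply Rlt_le, Rinv_0_lt_compat; lra] |].
  apply Rmult_le_reg_r with (INR n + 1); [lra |].
  unfold Rdiv; rewrite Rmult_assoc, Rinv_l; lra. }
rewrite Rabs_pos_eq.
- rewrite <- (Rmult_1_l (/ INR (fact n) * / INR (fact n))) at 2.
  apply Rmult_le_compat_r; nra.
- apply Rmult_le_pos; [apply pow_le; lra | nra].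
Qed.

Lemma fact_decay_k_mult (m : nat -> R) M a : 0 <= a ->
  (forall n, Rabs (m n) <= M * a ^ n) -> fact_decay (M * exp a) (fun n => k_coef n * m n).
Proof.
intros Ha Hm n; rewrite Rabs_mult.
assert (0 <= M).
{ specialize (Hm 0%nat); simpl in Hm; pose proof (Rabs_pos (m 0%nat)); lra. }
eapply Rle_trans.
{ apply Rmult_le_compat; try apply Rabs_pos; [apply k_coef_abs_le | apply Hm]. }
pose proof (pow_div_fact_le_exp a n Ha); pose proof (inv_fact_bounds n).
replace (/ INR (fact n) * / INR (fact n) * (M * a ^ n))
  with (M * (a ^ n / INR (fact n)) / INR (fact n)) by (unfold Rdiv; ring).
apply Rmult_le_compat_r; [lra |]; apply Rmult_le_compat_l; lra.
Qed.

Lemma fact_decay_k_dilate x : fact_decay (1 * exp (Rabs x)) (fun n => k_coef n * x ^ n).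
Proof.
apply fact_decay_k_mult; [apply Rabs_pos |].
intros n; rewrite <- RPow_abs; lra.
Qed.

Lemma k_diamond_dilate x y : k_diamond (x * y) = PSeries (fun n => k_coef n * x ^ n) y.
Proof.
unfold k_diamond, PSeries; apply Series_ext; intros n; rewrite Rpow_mult_distr.
unfold k_coef; ring.
Qed.

Lemma k_diamond_cont a x : continuous (fun y => k_diamond (a * y)) x.
Proof.
apply (continuous_ext (PSeries (fun n => k_coef n * a ^ n))).
- intros y; symmetry; apply k_diamond_dilate.
- eapply PSeries_continuous, fact_decay_k_dilate.
Qed.

Lemma fact_decay_k_moments f a : 0 <= a -> (forall x, continuous f x) ->
  exists C, fact_decay C (fun n => k_coef n * moment f a n).
Proof.
intros Ha Hf.
destruct (continuous_bounded_on f 0 a Ha Hf) as [M HM].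
exists (a * M * exp a); apply fact_decay_k_mult; [exact Ha |].
intros n; eapply Rle_trans; [apply moment_abs_le; eauto | right; ring].
Qed.

Lemma RInt_k_diamond f a x : 0 <= a -> (forall x, continuous f x) ->
  RInt (fun y => k_diamond (x * y) * f y) 0 a = PSeries (fun n => k_coef n * moment f a n) x.
Proof.
intros Ha Hf.
rewrite (RInt_ext_R _ (fun y => f y * PSeries (fun n => k_coef n * x ^ n) y))
  by (intros y; rewrite k_diamond_dilate; ring).
symmetry; apply is_series_unique.
eapply is_series_ext; [| eapply is_series_moments; [exact Ha | apply fact_decay_k_dilate | exact Hf]].
intros n; simpl; ring_R.
Qed.

Lemma k_diamond_exchange f g a b : 0 <= a -> 0 <= b ->
  (forall x, continuous f x) -> (forall x, continuous g x) ->
  RInt (fun x => g x * RInt (fun y => k_diamond (x * y) * f y) 0 a) 0 b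
  = RInt (fun y => f y * RInt (fun x => k_diamond (y * x) * g x) 0 b) 0 a.
Proof.
intros Ha Hb Hf Hg.
destruct (fact_decay_k_moments f a Ha Hf) as [C HC].
destruct (fact_decay_k_moments g b Hb Hg) as [D HD].
rewrite (RInt_ext_R _ (fun x => g x * PSeries (fun n => k_coef n * moment f a n) x))
  by (intros x; rewrite RInt_k_diamond by assumption; reflexivity).
rewrite (RInt_ext_R (fun y => f y * _) (fun y => f y * PSeries (fun n => k_coef n * moment g b n) y))
  by (intros y; rewrite RInt_k_diamond by assumption; reflexivity).
rewrite <- (is_series_unique _ _ (is_series_moments _ _ g b Hb HC Hg)).
rewrite <- (is_series_unique _ _ (is_series_moments _ _ f a Ha HD Hf)).
apply Series_ext; intros n; ring.
Qed.

(** Gronwall's argument backwards from [a]: [exp (M b) * int_b^a |f|] is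
    nondecreasing in [b], nonnegative, and vanishes at [a]. *)
Lemma gronwall_zero (f : R -> R) d a M : d <= a -> (forall x, continuous f x) ->
  (forall b, d <= b <= a -> Rabs (f b) <= M * RInt (fun y => Rabs (f y)) b a) ->
  f d = 0.
Proof.
intros Hda Hf Hle.
assert (CA : forall x, continuous (fun y => Rabs (f y)) x)
  by (intros x; apply (continuous_comp f Rabs); [apply Hf | apply continuous_Rabs]).
set (u := fun b => RInt (fun y => Rabs (f y)) b a) in *.
assert (Du : forall b, is_derive u b (- Rabs (f b))).
{ intros b; apply (is_derive_RInt' (V := R_NormedModule) (fun y => Rabs (f y)) u b a); [| apply CA].
  apply filter_forall; intros c; apply (RInt_correct (V := R_CompleteNormedModule)), ex_RInt_cont, CA. }
assert (Dw : forall b, is_derive (fun b => exp (M * b) * u b) b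
                         (exp (M * b) * (M * u b - Rabs (f b)))).
{ intros b; evar_last.
  { apply (is_derive_mult (fun b => exp (M * b)) u); [| apply Du | exact Rmult_comm].
    evar_last; [auto_derive; [trivial |] |]; reflexivity. }
  unfold plus, mult; simpl; ring_R. }
destruct (MVT_gen (fun b => exp (M * b) * u b) d a
  (fun b => exp (M * b) * (M * u b - Rabs (f b)))) as [c [Hc E]].
- intros x _; apply Dw.
- intros x _; apply continuity_pt_filterlim.
  apply (ex_derive_continuous (V := R_NormedModule) (fun b => exp (M * b) * u b)).
  eexists; apply Dw.
- rewrite Rmin_left, Rmax_right in Hc by lra.
  assert (Ua : u a = 0) by apply (RInt_point (V := R_CompleteNormedModule)).
  assert (0 <= exp (M * c) * (M * u c - Rabs (f c)) * (a - d)).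
  { apply Rmult_le_pos; [apply Rmult_le_pos |]; [apply Rlt_le, exp_pos | | lra].
    specialize (Hle c Hc); fold (u c) in Hle; lra. }
  assert (Hu0 : 0 <= u d).
  { apply RInt_ge_0; [exact Hda | apply ex_RInt_cont, CA | intros; apply Rabs_pos]. }
  rewrite Ua in E.
  pose proof (exp_pos (M * d)).
  assert (Hud : u d = 0) by nra.
  specialize (Hle d (conj (Rle_refl d) Hda)); fold (u d) in Hle.
  rewrite Hud, Rmult_0_r in Hle.
  pose proof (Rabs_pos (f d)); apply Rabs_eq_0; lra.
Qed.

(** Pair a null solution [f] on [(0,a)] with the solution [phi b] on [(0,b)],
    [b <= a]: as the kernel is symmetric, exchanging the two integrations leaves
    [eps * f b = - int_b^a f * phi b], a Volterra equation for [f]. *)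
Lemma null_solution_zero (eps a : R) (phi : R -> R -> R) (f : R -> R) :
  eps * eps = 1 -> 0 < a ->
  (forall b, 0 < b -> is_phi_diamond eps b (phi b)) ->
  (forall d, 0 < d <= a ->
     exists M, forall b y, d <= b <= a -> 0 <= y <= a -> Rabs (phi b y) <= M) ->
  (forall x, continuous f x) ->
  (forall x, f x + eps * RInt (fun y => k_diamond (x * y) * f y) 0 a = 0) ->
  forall x, f x = 0.
Proof.
intros He Ha Hphi HM Cf Hf.
assert (Volterra : forall b, 0 < b <= a -> eps * f b = - RInt (fun y => f y * phi b y) b a).
{ intros b Hb.
  destruct (Hphi b (proj1 Hb)) as [Cp Ep].
  pose proof (k_diamond_exchange f (phi b) a b (Rlt_le _ _ Ha) (Rlt_le _ _ (proj1 Hb)) Cf Cp) as X.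
  assert (Cfp : forall x, continuous (fun y => f y * phi b y) x)
    by (intros x; apply continuous_mult_R; auto).
  rewrite (RInt_ext_R (fun x => phi b x * _) (fun x => (- eps) * (f x * phi b x) + 0 * 0)) in X.
  2: { intros x.
       replace (RInt (fun y => k_diamond (x * y) * f y) 0 a) with (- eps * f x); [ring |].
       specialize (Hf x).
       apply Rmult_eq_reg_l with eps; [| nra].
       transitivity (- (eps * eps) * f x); [ring |]; rewrite He; lra. }
  rewrite (RInt_ext_R (fun y => f y * RInt (fun x => k_diamond (y * x) * phi b x) 0 b)
             (fun y => eps * (k_diamond (b * y) * f y) + (- eps) * (f y * phi b y))) in X.
  2: { intros y.
       replace (RInt (fun x => k_diamond (y * x) * phi b x) 0 b)
         with (eps * (k_diamond (b * y) - phi b y)); [ring |].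
       specialize (Ep y); rewrite <- Ep.
       transitivity ((eps * eps) * RInt (fun x => k_diamond (y * x) * phi b x) 0 b); [ring |].
       rewrite He; ring. }
  rewrite RInt_lin in X; [| exact Cfp | intros; apply continuous_const].
  rewrite RInt_lin in X; [| | exact Cfp].
  2: { intros x; apply continuous_mult_R; [apply k_diamond_cont | apply Cf]. }
  rewrite <- (RInt_Chasles (V := R_CompleteNormedModule) (fun y => f y * phi b y) 0 b a) in X
    by (apply ex_RInt_cont; exact Cfp).
  unfold plus in X; simpl in X.
  specialize (Hf b).
  set (K := RInt (fun y => k_diamond (b * y) * f y) 0 a) in *.
  set (P := RInt (fun y => f y * phi b y) 0 b) in *.
  set (Q := RInt (fun y => f y * phi b y) b a) in *.
  assert (eps * K = eps * Q) by lra.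
  assert (K = Q) by (apply Rmult_eq_reg_l with eps; [assumption | nra]).
  assert (eps * (f b + eps * K) = 0) by (rewrite Hf; ring).
  assert (eps * (eps * K) = K) by (rewrite <- Rmult_assoc, He; ring).
  lra. }
assert (Hin : forall d, 0 < d <= a -> f d = 0).
{ intros d Hd.
  destruct (HM d Hd) as [M HMd].
  apply gronwall_zero with (a := a) (M := M); [lra | exact Cf |].
  intros b Hb.
  assert (Rabs (f b) = Rabs (RInt (fun y => f y * phi b y) b a)) as ->.
  { rewrite <- (Rabs_Ropp (RInt _ _ _)), <- Volterra by lra.
    rewrite Rabs_mult; replace (Rabs eps) with 1; [ring |].
    pose proof (Rabs_pos eps); pose proof (Rabs_mult eps eps) as R.
    rewrite He, Rabs_R1 in R; nra. }
  assert (Cb : forall x, continuous (phi b) x) by (apply Hphi; lra).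
  eapply Rle_trans; [apply abs_RInt_le; [lra |] |].
  { apply ex_RInt_cont; intros x; apply continuous_mult_R; auto. }
  assert (CA : forall g : R -> R, (forall x, continuous g x) ->
                 forall x, continuous (fun y => Rabs (g y)) x)
    by (intros g Cg x; apply (continuous_comp g Rabs); [apply Cg | apply continuous_Rabs]).
  replace (M * RInt (fun y => Rabs (f y)) b a)
    with (RInt (fun y => M * Rabs (f y) + 0 * Rabs (f y)) b a)
    by (rewrite RInt_lin; [ring_R | apply CA, Cf | apply CA, Cf]).
  apply RInt_le; [lra | | |].
  - apply ex_RInt_cont, (CA (fun y => f y * phi b y)).
    intros x; apply continuous_mult_R; auto.
  - apply ex_RInt_cont; intros x; apply continuous_lin; apply CA, Cf.
  - intros y Hy; rewrite Rabs_mult.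
    assert (Rabs (phi b y) <= M) by (apply HMd; lra).
    pose proof (Rabs_pos (f y)); nra. }
intros x; specialize (Hf x).
rewrite (RInt_ext (V := R_CompleteNormedModule) _ (fun _ => 0)) in Hf.
- rewrite RInt_const in Hf; unfold scal in Hf; simpl in Hf; unfold mult in Hf; simpl in Hf; lra.
- intros y Hy; rewrite Rmin_left, Rmax_right in Hy by lra.
  rewrite Hin by lra; apply Rmult_0_r.
Qed.

(** * Bessel functions *)

(** The Bessel-Clifford function: [I_n (2 a) = a^n * clifford n (a^2)].  Unlike
    [I_n] it has [clifford (n + 1)] as its derivative. *)
Definition clifford_coef (n m : nat) : R := / (INR (fact m) * INR (fact (m + n))).
Definition clifford (n : nat) (z : R) : R := PSeries (clifford_coef n) z.

Lemma clifford_decay n : fact_decay (/ INR (fact n)) (clifford_coef n).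
Proof.
intros m; unfold clifford_coef, Rdiv.
pose proof (INR_fact_lt_0 m); pose proof (INR_fact_lt_0 n).
assert (INR (fact n) <= INR (fact (m + n))) by (apply le_INR, fact_le; lia).
rewrite Rabs_pos_eq, Rinv_mult, Rmult_comm.
- apply Rmult_le_compat_r; [apply Rlt_le, Rinv_0_lt_compat; assumption |].
  apply Rinv_le_contravar; assumption.
- apply Rlt_le, Rinv_0_lt_compat; nra.
Qed.

Lemma clifford_coef_pos n m : 0 < clifford_coef n m.
Proof.
apply Rinv_0_lt_compat, Rmult_lt_0_compat; apply INR_fact_lt_0.
Qed.

Lemma clifford_derive_coef n m : PS_derive (clifford_coef n) m = clifford_coef (S n) m.
Proof.
unfold PS_derive, clifford_coef.
replace (m + S n)%nat with (S m + n)%nat by lia.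
rewrite (fact_simpl m), mult_INR.
field; repeat split; try apply INR_fact_neq_0; apply not_0_INR; lia.
Qed.

Lemma clifford_derive n z : is_derive (clifford n) z (clifford (S n) z).
Proof.
evar_last; [eapply PSeries_derive, clifford_decay |].
apply PSeries_ext, clifford_derive_coef.
Qed.

Lemma clifford_rec n z : clifford n z = INR (S n) * clifford (S n) z + z * clifford (S (S n)) z.
Proof.
unfold clifford at 3.
rewrite (PSeries_ext (clifford_coef (S (S n))) (PS_derive (clifford_coef (S n))))
  by (intros m; symmetry; apply clifford_derive_coef).
rewrite (PSeries_euler _ _ _ (clifford_decay (S n))).
rewrite (PSeries_ext (fun m => INR m * clifford_coef (S n) m)
  (fun m => 1 * clifford_coef n m + (- INR (S n)) * clifford_coef (S n) m)).
- rewrite (PSeries_lin _ _ _ _ _ _ _ (clifford_decay n) (clifford_decay (S n))).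
  unfold clifford; ring.
- intros m; unfold clifford_coef.
  replace (m + S n)%nat with (S (m + n)) by lia.
  rewrite (fact_simpl (m + n)), mult_INR, !S_INR, plus_INR.
  pose proof (pos_INR m); pose proof (pos_INR n).
  field; repeat split; try apply INR_fact_neq_0; lra.
Qed.

Lemma clifford_ge n z : 0 <= z -> clifford_coef n 0 + z * clifford_coef n 1 <= clifford n z.
Proof.
intros Hz; eapply PSeries_ge_first_two; [apply clifford_decay | | exact Hz].
intros m; apply Rlt_le, clifford_coef_pos.
Qed.

Lemma clifford_0_ge_1 z : 0 <= z -> 1 <= clifford 0 z.
Proof.
intros Hz; pose proof (clifford_ge 0 z Hz); pose proof (clifford_coef_pos 0 1).
unfold clifford_coef at 1 in H; simpl in H; nra.
Qed.

Lemma clifford_1_ge z : 0 <= z -> 1 + z / 2 <= clifford 1 z.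
Proof.
intros Hz; pose proof (clifford_ge 1 z Hz).
unfold clifford_coef in H; simpl in H; lra.
Qed.

Definition bI (n : nat) (a : R) : R := BesselI n (2 * a).

Lemma bI_clifford n a : bI n a = a ^ n * clifford n (a ^ 2).
Proof.
unfold bI, BesselI; replace (2 * a / 2) with a by field; reflexivity.
Qed.

Lemma bI_rec n a : a * bI n a = INR (S n) * bI (S n) a + a * bI (S (S n)) a.
Proof.
rewrite !bI_clifford, (clifford_rec n); simpl pow; ring.
Qed.

Definition bI_bound (a : R) : R := exp a * exp (a ^ 2).

Lemma bI_bound_ge_0 a : 0 <= bI_bound a.
Proof. apply Rlt_le, Rmult_lt_0_compat; apply exp_pos. Qed.

Lemma bI_abs_le n a : 0 <= a -> Rabs (bI n a) <= bI_bound a.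
Proof.
intros Ha; rewrite bI_clifford, Rabs_mult.
pose proof (PSeries_abs_le _ _ (a ^ 2) (clifford_decay n)) as H.
fold (clifford n (a ^ 2)) in H.
rewrite (Rabs_pos_eq (a ^ 2)) in H by nra.
rewrite (Rabs_pos_eq (a ^ n)) by (apply pow_le, Ha).
eapply Rle_trans; [apply Rmult_le_compat_l; [apply pow_le, Ha | exact H] |].
unfold bI_bound; rewrite <- Rmult_assoc.
apply Rmult_le_compat_r; [apply Rlt_le, exp_pos |].
apply pow_div_fact_le_exp, Ha.
Qed.

Lemma clifford_sq_derive n a :
  is_derive (fun a => clifford n (a ^ 2)) a (2 * a * clifford (S n) (a ^ 2)).
Proof.
evar_last.
{ apply (is_derive_comp (clifford n) (fun a => a ^ 2)); [apply clifford_derive |].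
  apply is_derive_pow, (is_derive_id (K := R_AbsRing)). }
unfold scal, one; simpl; unfold mult; simpl; ring.
Qed.

Lemma bI_0_derive a : is_derive (bI 0) a (2 * bI 1 a).
Proof.
apply (is_derive_ext (fun a => clifford 0 (a ^ 2))).
{ intros t; rewrite bI_clifford; simpl; ring. }
evar_last; [apply clifford_sq_derive |].
rewrite bI_clifford; simpl pow; ring.
Qed.

Lemma bI_1_derive a : is_derive (bI 1) a (2 * bI 0 a - clifford 1 (a ^ 2)).
Proof.
apply (is_derive_ext (fun a => a * clifford 1 (a ^ 2))).
{ intros t; rewrite bI_clifford; simpl; ring. }
evar_last.
{ apply (is_derive_mult (fun a => a) (fun a => clifford 1 (a ^ 2)));
    [apply (is_derive_id (K := R_AbsRing)) | apply clifford_sq_derive | exact Rmult_comm]. }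
rewrite bI_clifford, (clifford_rec 0).
unfold plus, mult, one; simpl; ring.
Qed.

Lemma bI_1_clifford a : bI 1 a = a * clifford 1 (a ^ 2).
Proof. rewrite bI_clifford; simpl; ring. Qed.

Lemma bI_0_at_0 : bI 0 0 = 1.
Proof.
rewrite bI_clifford; unfold clifford; replace (0 ^ 2) with 0 by ring.
rewrite PSeries_at_0; unfold clifford_coef; simpl; field.
Qed.

Lemma bI_1_at_0 : bI 1 0 = 0.
Proof. rewrite bI_1_clifford; ring. Qed.

Lemma bI_1_ge_0 a : 0 <= a -> 0 <= bI 1 a.
Proof.
intros Ha; rewrite bI_1_clifford.
assert (H : 0 <= a ^ 2) by nra.
pose proof (clifford_1_ge _ H); nra.
Qed.

(** [bI 0 - bI 1] has the derivative [- 2 (bI 0 - bI 1) + bI 1 / a], where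
    [bI 1 / a >= 1 + a^2 / 2] forces more growth than [a / 4] needs. *)
Lemma bI_0_minus_1_gt a : 0 <= a -> a / 4 < bI 0 a - bI 1 a.
Proof.
intros Ha.
assert (H : exp (2 * 0) * (bI 0 0 - bI 1 0 - 0 / 4)
            <= exp (2 * a) * (bI 0 a - bI 1 a - a / 4)).
{ apply (increasing_le (fun x => exp (2 * x) * (bI 0 x - bI 1 x - x / 4))
    (fun x => exp (2 * x) * (clifford 1 (x ^ 2) - x / 2 - / 4))); [exact Ha | |].
  - intros x _; evar_last.
    { apply (is_derive_mult (fun x => exp (2 * x)) (fun x => bI 0 x - bI 1 x - x / 4));
        [| | exact Rmult_comm].
      - evar_last; [auto_derive; [trivial |] |]; reflexivity.
      - apply (is_derive_minus (V := R_NormedModule) (fun x => bI 0 x - bI 1 x) (fun x => x / 4)).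
        + apply (is_derive_minus (V := R_NormedModule)); [apply bI_0_derive | apply bI_1_derive].
        + evar_last; [auto_derive; [trivial |] |]; reflexivity. }
    unfold plus, minus, opp, mult; simpl; unfold plus; simpl; field.
  - intros x Hx; apply Rmult_le_pos; [apply Rlt_le, exp_pos |].
    assert (H : 0 <= x ^ 2) by nra; pose proof (clifford_1_ge _ H); nra. }
rewrite Rmult_0_r, exp_0, bI_0_at_0, bI_1_at_0 in H.
pose proof (exp_pos (2 * a)); nra.
Qed.

(** * The generating function of the Bessel functions *)

Definition u_coef (a : R) (n : nat) : R := (-1) ^ n * / INR (fact n) * bI n a.
Definition u (a : R) : R -> R := PSeries (u_coef a).
Definition u' (a : R) : R -> R := PSeries (PS_derive (u_coef a)).

Lemma u_decay a : 0 <= a -> fact_decay (bI_bound a) (u_coef a).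
Proof.
intros Ha n; unfold u_coef.
rewrite !Rabs_mult, pow_1_abs, Rmult_1_l, (Rabs_pos_eq (/ _))
  by apply Rlt_le, inv_fact_bounds.
unfold Rdiv; rewrite Rmult_comm; apply Rmult_le_compat_r.
- apply Rlt_le, inv_fact_bounds.
- apply bI_abs_le, Ha.
Qed.

Lemma u'_decay a : 0 <= a -> fact_decay (bI_bound a) (PS_derive (u_coef a)).
Proof. intros Ha; apply fact_decay_derive, u_decay, Ha. Qed.

Lemma u'_coef a n : PS_derive (u_coef a) n = - ((-1) ^ n * / INR (fact n) * bI (S n) a).
Proof.
unfold PS_derive, u_coef; rewrite fact_simpl, mult_INR; simpl pow.
field; split; [apply INR_fact_neq_0 | apply not_0_INR; lia].
Qed.

Lemma u_derive a x : 0 <= a -> is_derive (u a) x (u' a x).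
Proof. intros Ha; eapply PSeries_derive, u_decay, Ha. Qed.

Lemma u_continuous a x : 0 <= a -> continuous (u a) x.
Proof. intros Ha; eapply PSeries_continuous, u_decay, Ha. Qed.

Lemma u'_continuous a x : 0 <= a -> continuous (u' a) x.
Proof. intros Ha; eapply PSeries_continuous, u'_decay, Ha. Qed.

Lemma u_at_0 a : u a 0 = bI 0 a.
Proof. unfold u; rewrite PSeries_at_0; unfold u_coef; simpl; field. Qed.

Lemma u'_at_0 a : u' a 0 = - bI 1 a.
Proof. unfold u'; rewrite PSeries_at_0, u'_coef; simpl; field. Qed.

(** The three-term recurrence of the [I_n] is the equation [(a - x) u'' - u' = a u]
    satisfied by [I_0 (2 sqrt (a (a - x)))]. *)
Lemma u_ode a x : 0 <= a -> is_derive (fun x => (a - x) * u' a x) x (a * u a x).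
Proof.
intros Ha.
pose proof (u_decay a Ha) as H0; pose proof (u'_decay a Ha) as H1.
pose proof (fact_decay_derive _ _ H1) as H2.
evar_last.
{ apply (is_derive_mult (fun x => a - x) (u' a)); [| | exact Rmult_comm].
  - evar_last; [auto_derive; [trivial |] |]; reflexivity.
  - eapply PSeries_derive, H1. }
set (u'' := PSeries (PS_derive (PS_derive (u_coef a))) x).
unfold plus, mult; simpl.
assert (E : x * u'' = a * u'' - a * u a x - u' a x).
{ unfold u''; rewrite (PSeries_euler _ _ _ H1).
  rewrite (PSeries_ext _ (fun n => 1 * (a * PS_derive (PS_derive (u_coef a)) n + (- a) * u_coef a n)
                                   + (-1) * PS_derive (u_coef a) n)).
  - rewrite (PSeries_lin _ _ _ _ _ _ _ (fact_decay_lin _ _ _ _ _ _ H2 H0) H1).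
    rewrite (PSeries_lin _ _ _ _ _ _ _ H2 H0).
    unfold u, u'; ring.
  - intros n.
    unfold PS_derive at 2; rewrite !u'_coef; unfold u_coef.
    pose proof (bI_rec n a) as R.
    rewrite fact_simpl, mult_INR; simpl pow.
    replace ((-1) ^ n * / INR (fact n) * bI n a * - a)
      with (- ((-1) ^ n * / INR (fact n) * (a * bI n a))) by ring.
    replace (- a * ((-1) ^ n * / INR (fact n) * bI n a))
      with (- ((-1) ^ n * / INR (fact n) * (a * bI n a))) by ring.
    rewrite R, S_INR; pose proof (pos_INR n).
    field; split; [apply INR_fact_neq_0 | lra]. }
lra.
Qed.

Lemma clifford_affine_derive n a x :
  is_derive (fun x => clifford n (a * (a - x))) x (- a * clifford (S n) (a * (a - x))).
Proof.
evar_last.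
{ apply (is_derive_comp (clifford n) (fun x => a * (a - x))); [apply clifford_derive |].
  auto_derive; [trivial | reflexivity]. }
unfold scal; simpl; unfold mult; simpl; ring.
Qed.

(** Both sides solve the same equation, singular at [a], with the same initial
    data at [0]; so their Wronskian, multiplied by [a - x], vanishes. *)
Lemma u_wronskian a x : 0 < a ->
  (a - x) * (u' a x * clifford 0 (a * (a - x)) + a * u a x * clifford 1 (a * (a - x))) = 0.
Proof.
intros Ha.
set (v := fun n x => clifford n (a * (a - x))).
transitivity (((a - 0) * u' a 0) * v 0%nat 0 + u a 0 * (a * (a - 0) * v 1%nat 0)).
- transitivity (((a - x) * u' a x) * v 0%nat x + u a x * (a * (a - x) * v 1%nat x));
    [unfold v; ring |].
  apply (derive_zero_const (fun x => ((a - x) * u' a x) * v 0%nat x + u a x * (a * (a - x) * v 1%nat x))).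
  intros t; evar_last.
  { apply (is_derive_plus (V := R_NormedModule)).
    - apply (is_derive_mult (fun x => (a - x) * u' a x) (v 0%nat));
        [apply u_ode; lra | apply clifford_affine_derive | exact Rmult_comm].
    - apply (is_derive_mult (u a) (fun x => a * (a - x) * v 1%nat x)); [apply u_derive; lra | | exact Rmult_comm].
      apply (is_derive_mult (fun x => a * (a - x)) (v 1%nat)); [| apply clifford_affine_derive | exact Rmult_comm].
      auto_derive; [trivial | reflexivity]. }
  unfold v; rewrite (clifford_rec 0 (a * (a - t))).
  unfold plus, mult; simpl; ring.
- rewrite u_at_0, u'_at_0; unfold v; rewrite !bI_clifford.
  replace (a * (a - 0)) with (a ^ 2) by ring; simpl pow; ring.
Qed.

Lemma u_closed_form a x : 0 < a -> 0 <= x <= a -> u a x = clifford 0 (a * (a - x)).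
Proof.
intros Ha Hx.
assert (Hv : forall t, t <= a -> 0 < clifford 0 (a * (a - t))).
{ intros t Ht; assert (Hz : 0 <= a * (a - t)) by nra.
  pose proof (clifford_0_ge_1 _ Hz); lra. }
set (w := fun x => u a x / clifford 0 (a * (a - x))).
assert (Dw : forall t, t <= a -> is_derive w t
  ((u' a t * clifford 0 (a * (a - t)) + a * u a t * clifford 1 (a * (a - t)))
   / (clifford 0 (a * (a - t))) ^ 2)).
{ intros t Ht; specialize (Hv t Ht).
  evar_last.
  { apply (is_derive_div (u a) (fun x => clifford 0 (a * (a - x))));
      [apply u_derive; lra | apply clifford_affine_derive | lra]. }
  simpl; field; lra. }
destruct (MVT_gen w 0 x (fun _ => 0)) as [c [_ E]].
- intros t; rewrite Rmin_left, Rmax_right by lra; intros Ht.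
  evar_last; [apply Dw; lra |].
  pose proof (u_wronskian a t Ha) as W.
  apply Rmult_integral in W; destruct W as [W|W]; [lra |].
  rewrite W; unfold Rdiv; ring.
- intros t; rewrite Rmin_left, Rmax_right by lra; intros Ht.
  apply continuity_pt_filterlim.
  apply (ex_derive_continuous (V := R_NormedModule) w); eexists; apply Dw; lra.
- unfold w in E; rewrite u_at_0, bI_clifford in E.
  replace (a * (a - 0)) with (a ^ 2) in E by ring.
  assert (H0 : 0 <= a ^ 2) by nra; pose proof (clifford_0_ge_1 _ H0).
  assert (Hx' := Hv x (proj2 Hx)).
  replace (a ^ 0 * clifford 0 (a ^ 2) / clifford 0 (a ^ 2)) with 1 in E by (rewrite pow_O; field; lra).
  apply Rmult_eq_reg_r with (/ clifford 0 (a * (a - x)));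
    [| apply Rinv_neq_0_compat; lra].
  rewrite Rinv_r by lra; unfold Rdiv in E; lra.
Qed.

Lemma u'_closed_form a x : 0 < a -> 0 <= x < a -> u' a x = - a * clifford 1 (a * (a - x)).
Proof.
intros Ha Hx.
pose proof (u_wronskian a x Ha) as W.
rewrite (u_closed_form a x Ha) in W by lra.
apply Rmult_integral in W; destruct W as [W|W]; [lra |].
assert (Hz : 0 <= a * (a - x)) by nra.
pose proof (clifford_0_ge_1 _ Hz).
apply Rmult_eq_reg_r with (clifford 0 (a * (a - x))); [| lra]; lra.
Qed.

Lemma clifford_at_0 n : clifford n 0 = / INR (fact n).
Proof.
unfold clifford; rewrite PSeries_at_0; unfold clifford_coef; simpl.
rewrite Rmult_1_l; reflexivity.
Qed.

Lemma u_at_a a : 0 < a -> u a a = 1.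
Proof.
intros Ha; rewrite u_closed_form by lra.
replace (a * (a - a)) with 0 by ring; rewrite clifford_at_0; simpl; field.
Qed.

Lemma u'_at_a a : 0 < a -> u' a a = - a.
Proof.
intros Ha.
(* The equation for [u], singular at [a], degenerates there to [- u' = a u]. *)
pose proof (u_ode a a (Rlt_le _ _ Ha)) as D1.
assert (D2 : is_derive (fun x => (a - x) * u' a x) a (- u' a a)).
{ evar_last.
  { apply (is_derive_mult (fun x => a - x) (u' a)); [| | exact Rmult_comm].
    - evar_last; [auto_derive; [trivial |] |]; reflexivity.
    - eapply PSeries_derive, u'_decay; lra. }
  unfold plus, mult; simpl; ring. }
apply is_derive_unique in D1; apply is_derive_unique in D2.
rewrite (u_at_a a Ha) in D1; lra.
Qed.

Lemma moments_u_u' a n : 0 < a ->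
  moment (u a) a n = INR (fact n) * bI (S n) a /\
  moment (u' a) a n = a ^ n - INR (fact n) * bI n a.
Proof.
intros Ha; assert (Ha' := Rlt_le _ _ Ha).
assert (Du := fun x => u_derive a x Ha').
assert (Cu := fun x => u_continuous a x Ha').
assert (Cu' := fun x => u'_continuous a x Ha').
assert (Dw := fun x => u_ode a x Ha').
assert (Cau : forall x, continuous (fun x : R => a * u a x + 0 * u a x) x)
  by (intros; apply continuous_lin; apply Cu).
assert (Dw' : forall x, is_derive (fun x : R => (a - x) * u' a x) x (a * u a x + 0 * u a x)).
{ intros x; evar_last; [apply Dw | ring]. }
induction n as [|n [IH IH']].
- rewrite !moment_0; split.
  + pose proof (RInt_of_derive _ _ 0 a Dw' Cau) as E.
    rewrite RInt_lin in E by exact Cu.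
    rewrite u'_at_0 in E; simpl.
    apply Rmult_eq_reg_l with a; [| lra]; lra.
  + rewrite (RInt_of_derive _ _ 0 a Du Cu').
    rewrite u_at_a, u_at_0 by exact Ha; simpl; ring.
- assert (E' : moment (u' a) a (S n) = a ^ S n - INR (fact (S n)) * bI (S n) a).
  { rewrite (moment_by_parts _ _ a n Du Cu'), u_at_a, IH by exact Ha.
    rewrite fact_simpl, mult_INR; ring. }
  split; [| exact E'].
  pose proof (moment_by_parts _ _ a n Dw' Cau) as E.
  rewrite moment_lin in E by exact Cu.
  assert (Ew : moment (fun x => (a - x) * u' a x) a n
               = a * moment (u' a) a n - moment (u' a) a (S n)).
  { unfold moment.
    rewrite (RInt_ext_R _ (fun y => a * (y ^ n * u' a y) + (-1) * (y ^ S n * u' a y)))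
      by (intros y; simpl; ring).
    rewrite RInt_lin; [ring_R | |];
      intros y; (apply continuous_mult_R; [apply continuous_pow | apply Cu']). }
  rewrite Ew, IH', E' in E.
  pose proof (bI_rec n a) as Rec.
  rewrite fact_simpl, mult_INR in *; simpl pow in *.
  apply Rmult_eq_reg_l with a; [| lra].
  replace (a * (INR (S n) * INR (fact n) * bI (S (S n)) a))
    with (INR (S n) * INR (fact n) * (a * bI (S (S n)) a)) by ring.
  replace (a * bI (S (S n)) a) with (a * bI n a - INR (S n) * bI (S n) a) by lra.
  transitivity (a * RInt (fun y => y ^ S n * u a y) 0 a + 0); [unfold moment; ring_R |].
  unfold moment in E; simpl pow in *.
  lra.
Qed.

(** * Averages of power series *)

(** The coefficients of [x |-> (1/x) int_0^x f]. *)
Definition avg (c : nat -> R) (n : nat) : R := / INR (S n) * c n.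

Lemma inv_S_bounds n : 0 < / INR (S n) <= 1.
Proof.
pose proof (pos_INR n); rewrite S_INR; split.
- apply Rinv_0_lt_compat; lra.
- rewrite <- Rinv_1; apply Rinv_le_contravar; lra.
Qed.

Lemma avg_decay C c : fact_decay C c -> fact_decay (1 * C) (avg c).
Proof.
intros H; apply fact_decay_mult; [exact H |].
intros n; pose proof (inv_S_bounds n); rewrite Rabs_pos_eq; lra.
Qed.

Lemma avg_derive C c x : fact_decay C c ->
  is_derive (fun x : R => x * PSeries (avg c) x) x (PSeries c x).
Proof.
intros H; pose proof (avg_decay _ _ H) as HA.
evar_last.
{ apply (is_derive_mult (fun x => x) (PSeries (avg c)));
    [apply (is_derive_id (K := R_AbsRing)) | eapply PSeries_derive, HA | exact Rmult_comm]. }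
unfold plus, mult, one; simpl.
rewrite (PSeries_euler _ _ _ HA).
rewrite (PSeries_ext (fun n => INR n * avg c n) (fun n => 1 * c n + (-1) * avg c n)).
- rewrite (PSeries_lin _ _ _ _ _ _ _ H HA); ring.
- intros n; unfold avg; pose proof (pos_INR n); rewrite S_INR; field; lra.
Qed.

Lemma avg_at C c a : fact_decay C c ->
  a * PSeries (avg c) a = moment (PSeries c) a 0.
Proof.
intros H; rewrite moment_0.
rewrite (RInt_of_derive (fun x => x * PSeries (avg c) x)).
- ring.
- intros x; eapply avg_derive, H.
- intros x; eapply PSeries_continuous, H.
Qed.

Lemma moment_avg C c a n : fact_decay C c ->
  INR (S n) * moment (PSeries (avg c)) a (S n)
  = a ^ S n * moment (PSeries c) a 0 - moment (PSeries c) a (S n).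
Proof.
intros H.
rewrite <- (avg_at _ _ a H).
rewrite (moment_by_parts (fun x : R => x * PSeries (avg c) x) (PSeries c) a n).
- replace (moment (fun x : R => x * PSeries (avg c) x) a n) with (moment (PSeries (avg c)) a (S n)).
  + ring.
  + apply RInt_ext_R; intros y; simpl; ring.
- intros x; eapply avg_derive, H.
- intros x; eapply PSeries_continuous, H.
Qed.

(** The coefficients of [L f = f - (1/x) int_0^x f]. *)
Definition L_coef (c : nat -> R) (n : nat) : R := INR n / INR (S n) * c n.

Lemma L_coef_avg c n : L_coef c n = 1 * c n + (-1) * avg c n.
Proof.
unfold L_coef, avg; pose proof (pos_INR n); rewrite S_INR; field; lra.
Qed.

Lemma L_decay C c : fact_decay C c -> fact_decay (Rabs 1 * C + Rabs (-1) * (1 * C)) (L_coef c).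
Proof.
intros H; apply fact_decay_ext with (fun n => 1 * c n + (-1) * avg c n).
- intros n; symmetry; apply L_coef_avg.
- apply fact_decay_lin; [exact H | apply avg_decay, H].
Qed.

Lemma PSeries_L C c x : fact_decay C c ->
  PSeries (L_coef c) x = 1 * PSeries c x + (-1) * PSeries (avg c) x.
Proof.
intros H; rewrite (PSeries_ext _ _ _ (L_coef_avg c)).
eapply PSeries_lin; [exact H | apply avg_decay, H].
Qed.

(** On [(0,a)] the adjoint of [L] following [L] only subtracts the mean value,
    whence the simple shape of these moments. *)
Lemma moment_L C c a n : fact_decay C c ->
  INR n / INR (S n) * moment (PSeries (L_coef c)) a n
  = moment (PSeries c) a n - a ^ n / INR (S n) * moment (PSeries c) a 0.
Proof.
intros H; destruct n as [|n].
- simpl; field.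
- assert (E : moment (PSeries (L_coef c)) a (S n)
              = moment (PSeries c) a (S n) - moment (PSeries (avg c)) a (S n)).
  { unfold moment at 1.
    rewrite (RInt_ext_R _ (fun y => y ^ S n * (1 * PSeries c y + (-1) * PSeries (avg c) y)))
      by (intros y; rewrite (PSeries_L _ _ _ H); reflexivity).
    fold (moment (fun y => 1 * PSeries c y + (-1) * PSeries (avg c) y) a (S n)).
    rewrite moment_lin; [ring | |]; intros x; eapply PSeries_continuous;
      [exact H | apply avg_decay, H]. }
  pose proof (moment_avg _ _ a n H) as A.
  pose proof (pos_INR n); rewrite !S_INR in *.
  assert (M : moment (PSeries (avg c)) a (S n)
    = (a ^ S n * moment (PSeries c) a 0 - moment (PSeries c) a (S n)) / (INR n + 1)).
  { rewrite <- A; field; lra. }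
  rewrite E, M; field; lra.
Qed.

(** * The two auxiliary functions *)

(** [s] and [d] are, up to a factor, the sum and the difference of the solutions
    of [chi +- H_a chi = 1], [H_a] having the kernel [J_0 (2 sqrt (x y))] on
    [(0,a)].  They are found from [x s' = a (I_0 u' + I_1 u)] and
    [(x d)' = - a (I_0 u + I_1 u')], which express that [x d/dx + 1/2]
    anticommutes with [H_a] up to boundary terms. *)
Definition d_rhs_coef (a : R) (n : nat) : R :=
  (- a * bI 0 a) * u_coef a n + (- a * bI 1 a) * PS_derive (u_coef a) n.
Definition d_coef (a : R) : nat -> R := avg (d_rhs_coef a).
Definition d (a : R) : R -> R := PSeries (d_coef a).

Definition s_rhs_coef (a : R) (n : nat) : R :=
  (a * bI 1 a) * u_coef a n + (a * bI 0 a) * PS_derive (u_coef a) n.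
Definition s_tail (a : R) (n : nat) : R := / INR n * s_rhs_coef a n.
(** The constant term is chosen so that [s a a = I_0]. *)
Definition s_coef (a : R) (n : nat) : R :=
  match n with
  | 0 => bI 0 a - a * PSeries (PS_decr_1 (s_tail a)) a
  | S _ => s_tail a n
  end.
Definition s (a : R) : R -> R := PSeries (s_coef a).

Definition rhs_bound (a : R) : R := 2 * (a * (bI_bound a * bI_bound a)).

Lemma rhs_coef_abs_le a i j n : 0 <= a -> forall e,
  Rabs (e * a * bI i a) <= a * bI_bound a -> Rabs (e * a * bI j a) <= a * bI_bound a ->
  Rabs ((e * a * bI i a) * u_coef a n + (e * a * bI j a) * PS_derive (u_coef a) n)
  <= rhs_bound a / INR (fact n).
Proof.
intros Ha e Hi Hj.
pose proof (u_decay a Ha n) as U; pose proof (u'_decay a Ha n) as U'.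
eapply Rle_trans; [apply Rabs_triang |]; rewrite !Rabs_mult with (y := u_coef a n),
  !Rabs_mult with (y := PS_derive (u_coef a) n).
replace (rhs_bound a / INR (fact n))
  with ((a * bI_bound a) * (bI_bound a / INR (fact n))
        + (a * bI_bound a) * (bI_bound a / INR (fact n)))
  by (unfold rhs_bound, Rdiv; ring).
apply Rplus_le_compat; apply Rmult_le_compat; try apply Rabs_pos; assumption.
Qed.

Lemma scaled_bI_le a i e : 0 <= a -> Rabs e = 1 -> Rabs (e * a * bI i a) <= a * bI_bound a.
Proof.
intros Ha He; rewrite !Rabs_mult, He, (Rabs_pos_eq a) by exact Ha.
rewrite Rmult_1_l; apply Rmult_le_compat_l; [exact Ha | apply bI_abs_le, Ha].
Qed.

Lemma d_rhs_decay a : 0 <= a -> fact_decay (rhs_bound a) (d_rhs_coef a).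
Proof.
intros Ha n; unfold d_rhs_coef.
replace (- a) with ((-1) * a) by ring.
assert (E : Rabs (-1) = 1) by (rewrite Rabs_left; lra).
apply rhs_coef_abs_le; [exact Ha | |]; apply scaled_bI_le; assumption.
Qed.

Lemma s_rhs_decay a : 0 <= a -> fact_decay (rhs_bound a) (s_rhs_coef a).
Proof.
intros Ha n; unfold s_rhs_coef.
replace (a * bI 0 a) with (1 * a * bI 0 a) by ring.
replace (a * bI 1 a) with (1 * a * bI 1 a) by ring.
apply rhs_coef_abs_le; [exact Ha | |]; apply scaled_bI_le; trivial; apply Rabs_R1.
Qed.

Lemma d_decay a : 0 <= a -> fact_decay (1 * rhs_bound a) (d_coef a).
Proof. intros Ha; apply avg_decay, d_rhs_decay, Ha. Qed.

Lemma rhs_bound_ge_0 a : 0 <= a -> 0 <= rhs_bound a.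
Proof.
intros Ha; pose proof (bI_bound_ge_0 a); unfold rhs_bound.
apply Rmult_le_pos; [lra |]; apply Rmult_le_pos; [exact Ha |]; apply Rmult_le_pos; assumption.
Qed.

Lemma s_tail_decay a : 0 <= a -> fact_decay (1 * rhs_bound a) (s_tail a).
Proof.
intros Ha; apply (fact_decay_mult _ (fun n => / INR n)); [apply s_rhs_decay, Ha |].
intros [|n]; [simpl; rewrite Rinv_0, Rabs_R0; lra |].
pose proof (inv_S_bounds n); rewrite Rabs_pos_eq; lra.
Qed.

Lemma s_decay a : 0 <= a -> exists C, fact_decay C (s_coef a).
Proof.
intros Ha; exists (Rabs (s_coef a 0) + rhs_bound a); intros n.
pose proof (rhs_bound_ge_0 a Ha); pose proof (Rabs_pos (s_coef a 0)).
pose proof (inv_fact_bounds n).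
destruct n as [|n].
- simpl INR; unfold Rdiv; rewrite Rinv_1; lra.
- eapply Rle_trans; [apply (s_tail_decay a Ha (S n)) |].
  rewrite Rmult_1_l; unfold Rdiv; apply Rmult_le_compat_r; lra.
Qed.

Lemma s_at_a a : 0 <= a -> s a a = bI 0 a.
Proof.
intros Ha; destruct (s_decay a Ha) as [C HC].
unfold s; rewrite PSeries_decr_1 by (eapply fact_decay_ex_pseries, HC).
replace (PSeries (PS_decr_1 (s_coef a)) a) with (PSeries (PS_decr_1 (s_tail a)) a)
  by (apply PSeries_ext; reflexivity).
simpl; ring.
Qed.

Lemma PSeries_s_rhs a x : 0 <= a ->
  PSeries (s_rhs_coef a) x = (a * bI 1 a) * u a x + (a * bI 0 a) * u' a x.
Proof. intros Ha; eapply PSeries_lin; [apply u_decay, Ha | apply u'_decay, Ha]. Qed.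

Lemma PSeries_d_rhs a x : 0 <= a ->
  PSeries (d_rhs_coef a) x = (- a * bI 0 a) * u a x + (- a * bI 1 a) * u' a x.
Proof. intros Ha; eapply PSeries_lin; [apply u_decay, Ha | apply u'_decay, Ha]. Qed.

Lemma moment_s_rhs a n : 0 < a -> moment (PSeries (s_rhs_coef a)) a n
  = a * (bI 1 a * (INR (fact n) * bI (S n) a) + bI 0 a * (a ^ n - INR (fact n) * bI n a)).
Proof.
intros Ha; destruct (moments_u_u' a n Ha) as [<- <-].
transitivity (moment (fun x => (a * bI 1 a) * u a x + (a * bI 0 a) * u' a x) a n).
- apply RInt_ext_R; intros x; rewrite PSeries_s_rhs by lra; reflexivity.
- rewrite moment_lin; [ring | |]; intros x; [apply u_continuous | apply u'_continuous]; lra.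
Qed.

Lemma moment_d_rhs a n : 0 < a -> moment (PSeries (d_rhs_coef a)) a n
  = - a * (bI 0 a * (INR (fact n) * bI (S n) a) + bI 1 a * (a ^ n - INR (fact n) * bI n a)).
Proof.
intros Ha; destruct (moments_u_u' a n Ha) as [<- <-].
transitivity (moment (fun x => (- a * bI 0 a) * u a x + (- a * bI 1 a) * u' a x) a n).
- apply RInt_ext_R; intros x; rewrite PSeries_d_rhs by lra; reflexivity.
- rewrite moment_lin; [ring | |]; intros x; [apply u_continuous | apply u'_continuous]; lra.
Qed.

(** Together with the next lemma: [H_a s = - d], and [s + H_a d] is constant. *)
Lemma moment_s a n : 0 < a -> INR (S n) * moment (s a) a n
  = a * INR (fact n) * (bI 0 a * bI n a - bI 1 a * bI (S n) a).
Proof.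
intros Ha; destruct (s_decay a (Rlt_le _ _ Ha)) as [C HC].
assert (E : moment (PSeries (PS_derive (s_coef a))) a (S n) = moment (PSeries (s_rhs_coef a)) a n).
{ apply RInt_ext_R; intros y.
  transitivity (y ^ n * (y * PSeries (PS_derive (s_coef a)) y)); [simpl; ring |].
  f_equal; symmetry; apply PSeries_shift.
  - unfold s_rhs_coef; rewrite u'_coef; unfold u_coef; simpl; field.
  - intros k; unfold PS_derive, s_coef, s_tail.
    field; apply not_0_INR; lia. }
rewrite (moment_by_parts (s a)) in E.
- rewrite s_at_a, moment_s_rhs in E by lra; simpl pow in E; lra.
- intros x; eapply PSeries_derive, HC.
- intros x; eapply PSeries_continuous, fact_decay_derive, HC.
Qed.

Lemma moment_d a n : 0 < a -> INR (S n) * moment (d a) a (S n)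
  = a * INR (fact (S n)) * (bI 0 a * bI (S (S n)) a - bI 1 a * bI (S n) a).
Proof.
intros Ha; unfold d, d_coef.
rewrite (moment_avg (rhs_bound a)) by (apply d_rhs_decay; lra).
rewrite !moment_d_rhs by exact Ha; simpl (fact 0); simpl (INR 1); simpl (a ^ 0); ring.
Qed.

Lemma d_at_a a : 0 < a -> d a a = - bI 1 a.
Proof.
intros Ha.
assert (E : a * d a a = a * - bI 1 a).
{ unfold d, d_coef; rewrite (avg_at (rhs_bound a)) by (apply d_rhs_decay; lra).
  rewrite moment_d_rhs by exact Ha; simpl; ring. }
apply Rmult_eq_reg_l with a; lra.
Qed.

(** * The integral of [d] over [(0,a)] *)

Fixpoint harmonic (n : nat) : R :=
  match n with 0 => 0 | S m => harmonic m + / INR (S m) end.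

Lemma harmonic_bounds n : 0 <= harmonic n <= INR n.
Proof.
induction n as [|n IH]; [simpl; lra |].
change (harmonic (S n)) with (harmonic n + / INR (S n)).
pose proof (inv_S_bounds n); pose proof (S_INR n); lra.
Qed.

Lemma INR_le_fact n : INR n <= INR (fact n).
Proof.
apply le_INR; destruct n as [|n]; [simpl; lia |].
rewrite fact_simpl; pose proof (lt_O_fact n); nia.
Qed.

(** Term by term, [beta z = sum_m H_m z^m / m!^2] is the integral over [(0,1)]
    of [(I_0 (2 sqrt z) - I_0 (2 sqrt (z (1 - t)))) / t]. *)
Definition beta_coef (n : nat) : R := harmonic n * clifford_coef 0 n.
Definition beta (z : R) : R := PSeries beta_coef z.
Definition beta' (z : R) : R := PSeries (PS_derive beta_coef) z.

Lemma beta_decay : fact_decay 1 beta_coef.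
Proof.
intros n; unfold beta_coef, clifford_coef; rewrite Nat.add_0_r.
pose proof (harmonic_bounds n); pose proof (INR_le_fact n); pose proof (INR_fact_lt_0 n).
pose proof (inv_fact_bounds n).
rewrite Rinv_mult, Rabs_pos_eq.
- unfold Rdiv; rewrite Rmult_1_l, <- Rmult_assoc.
  rewrite <- (Rmult_1_l (/ INR (fact n))) at 3.
  apply Rmult_le_compat_r; [lra |].
  rewrite <- (Rinv_r (INR (fact n))) by lra.
  apply Rmult_le_compat_r; lra.
- apply Rmult_le_pos; [lra |]; apply Rmult_le_pos; lra.
Qed.

Lemma beta'_euler z : is_derive (fun z : R => z * beta' z) z (beta z + clifford 1 z).
Proof.
pose proof beta_decay as H0; pose proof (fact_decay_derive _ _ H0) as H1.
evar_last.
{ apply (is_derive_mult (fun x => x) beta');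
    [apply (is_derive_id (K := R_AbsRing)) | eapply PSeries_derive, H1 | exact Rmult_comm]. }
unfold plus, mult, one; simpl.
rewrite (PSeries_euler _ _ _ H1).
rewrite (PSeries_ext _ (fun n => 1 * (1 * beta_coef n + 1 * clifford_coef 1 n)
                                 + (-1) * PS_derive beta_coef n)).
- rewrite (PSeries_lin _ _ _ _ _ _ _ (fact_decay_lin _ _ _ _ _ _ H0 (clifford_decay 1)) H1).
  rewrite (PSeries_lin _ _ _ _ _ _ _ H0 (clifford_decay 1)).
  unfold beta, beta', clifford; ring.
- intros n; unfold PS_derive, beta_coef, clifford_coef.
  change (harmonic (S n)) with (harmonic n + / INR (S n)).
  rewrite !Nat.add_0_r, Nat.add_1_r, fact_simpl, mult_INR, S_INR.
  pose proof (pos_INR n); field; split; [apply INR_fact_neq_0 | lra].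
Qed.

(** Both sides vanish at [0] and have the derivative [I_0 * I_0']. *)
Lemma harmonic_wronskian z :
  z * (clifford 0 z * beta' z - clifford 1 z * beta z) = (clifford 0 z ^ 2 - 1) / 2.
Proof.
set (G := fun z => clifford 0 z * (z * beta' z) - (z * clifford 1 z) * beta z
                   - clifford 0 z * clifford 0 z / 2).
assert (D : forall t, is_derive G t 0).
{ intros t; evar_last.
  { apply (is_derive_minus (V := R_NormedModule)); [apply (is_derive_minus (V := R_NormedModule)) |].
    - apply (is_derive_mult (clifford 0) (fun z => z * beta' z));
        [apply clifford_derive | apply beta'_euler | exact Rmult_comm].
    - apply (is_derive_mult (fun z => z * clifford 1 z) beta);
        [| eapply PSeries_derive, beta_decay | exact Rmult_comm].
      apply (is_derive_mult (fun z => z) (clifford 1));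
        [apply (is_derive_id (K := R_AbsRing)) | apply clifford_derive | exact Rmult_comm].
    - apply (is_derive_ext (fun z => (/ 2) * (clifford 0 z * clifford 0 z)));
        [intros; simpl; field |].
      apply is_derive_scal, (is_derive_mult (clifford 0) (clifford 0));
        [apply clifford_derive | apply clifford_derive | exact Rmult_comm]. }
  fold (beta' t); pose proof (clifford_rec 0 t) as R0.
  unfold minus, opp, plus, mult, one; simpl; unfold plus, mult; simpl.
  simpl in R0; rewrite R0; field. }
pose proof (derive_zero_const G z 0 D) as E; unfold G in E.
rewrite !(clifford_at_0 0) in E; simpl in E.
rewrite !Rmult_0_l, Rinv_1 in E; nra.
Qed.

(** This is [(a^m - (a - x)^m) / x], in a form that stays continuous at [x = 0]. *)
Fixpoint pow_quotient (a : R) (m : nat) (x : R) : R :=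
  match m with 0 => 0 | S k => a * pow_quotient a k x + (a - x) ^ k end.

Lemma pow_quotient_eq a m x : x * pow_quotient a m x = a ^ m - (a - x) ^ m.
Proof.
induction m as [|m IH]; [simpl; ring |].
simpl; replace (a * a ^ m) with (a * (x * pow_quotient a m x + (a - x) ^ m)) by (rewrite IH; ring).
ring.
Qed.

Lemma pow_quotient_derive a m x : ex_derive (pow_quotient a m) x.
Proof.
induction m as [|m IH]; [apply ex_derive_const |].
apply (ex_derive_plus (V := R_NormedModule) (fun x => a * pow_quotient a m x)).
- apply ex_derive_scal, IH.
- auto_derive; trivial.
Qed.

Lemma pow_quotient_continuous a m x : continuous (pow_quotient a m) x.
Proof. apply (ex_derive_continuous (V := R_NormedModule)), pow_quotient_derive. Qed.

Lemma pow_quotient_le a m x : 0 <= a -> 0 <= x <= a ->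
  Rabs (pow_quotient a m x) <= INR m * (a + 1) ^ m.
Proof.
intros Ha Hx; induction m as [|m IH]; [simpl; rewrite Rabs_R0; lra |].
simpl pow_quotient; eapply Rle_trans; [apply Rabs_triang |].
rewrite Rabs_mult, (Rabs_pos_eq a), (Rabs_pos_eq ((a - x) ^ m)) by (try apply pow_le; lra).
assert (P : (a - x) ^ m <= (a + 1) ^ m) by (apply pow_incr; lra).
assert (P0 : 0 <= (a + 1) ^ m) by (apply pow_le; lra).
rewrite S_INR; simpl pow; pose proof (pos_INR m).
assert (a * Rabs (pow_quotient a m x) <= a * (INR m * (a + 1) ^ m))
  by (apply Rmult_le_compat_l; assumption).
assert (0 <= INR m * (a + 1) ^ m) by (apply Rmult_le_pos; assumption).
assert (0 <= a * (a + 1) ^ m) by (apply Rmult_le_pos; assumption).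
nra.
Qed.

Lemma RInt_pow_quotient a m : RInt (pow_quotient a m) 0 a = harmonic m * a ^ m.
Proof.
induction m as [|m IH].
- rewrite (RInt_ext_R _ (fun _ => 0)) by reflexivity.
  rewrite RInt_const; unfold scal; simpl; unfold mult; simpl; ring.
- rewrite (RInt_ext_R _ (fun x => a * pow_quotient a m x + 1 * (a - x) ^ m))
    by (intros; simpl; ring).
  rewrite RInt_lin.
  + rewrite IH, (RInt_of_derive (fun x => - / INR (S m) * (a - x) ^ S m)).
    * change (harmonic (S m)) with (harmonic m + / INR (S m)).
      rewrite !Rminus_0_r, Rminus_diag, (pow_ne_zero (S m)) by discriminate.
      simpl pow; ring_R.
    * intros x; auto_derive; [trivial |].
      change (match m with 0%nat => 1 | S _ => INR m + 1 end) with (INR (S m)).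
      apply Rmult_eq_reg_l with (INR (S m)); [| apply not_0_INR; lia].
      change (a + - x) with (a - x).
      transitivity ((INR (S m) * / INR (S m)) * (INR (S m) * (a - x) ^ m)); [ring_R |].
      rewrite Rinv_r by (apply not_0_INR; lia); ring_R.
    * intros x; apply (ex_derive_continuous (V := R_NormedModule)); auto_derive; trivial.
  + intros x; apply pow_quotient_continuous.
  + intros x; apply (ex_derive_continuous (V := R_NormedModule)); auto_derive; trivial.
Qed.

Lemma mult_x_d a x : 0 < a ->
  x * d a x = - (bI 0 a * ((a - x) * u' a x + a * bI 1 a) + a * bI 1 a * (u a x - bI 0 a)).
Proof.
intros Ha; assert (Ha' := Rlt_le _ _ Ha).
set (X := fun x => bI 0 a * ((a - x) * u' a x) + a * bI 1 a * u a x).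
assert (D : forall t, is_derive (fun x => x * d a x + X x) t 0).
{ intros t; evar_last.
  { apply (is_derive_plus (V := R_NormedModule)).
    - eapply avg_derive, d_rhs_decay, Ha'.
    - apply (is_derive_plus (V := R_NormedModule)); apply is_derive_scal;
        [apply u_ode, Ha' | apply u_derive, Ha']. }
  rewrite PSeries_d_rhs by exact Ha'; unfold plus; simpl; ring. }
pose proof (derive_zero_const _ x 0 D) as E; cbv beta in E; unfold X in E.
rewrite u_at_0, u'_at_0 in E; lra.
Qed.

(** By the closed form of [u] on [(0,a)], [x * d a x] only involves differences of
    Bessel-Clifford functions between [a^2] and [a (a - x)]; dividing them by [x]
    power by power leaves polynomials integrating to [H_m a^m]. *)
Definition gamma_coef (a : R) (m : nat) : R :=
  - (bI 0 a * (INR m * clifford_coef 0 m) - a * bI 1 a * clifford_coef 0 m).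

Lemma d_series a x : 0 < a -> 0 < x < a ->
  is_series (fun m => gamma_coef a m * a ^ m * pow_quotient a m x) (d a x).
Proof.
intros Ha Hx.
assert (S1 : forall z, is_series (fun m => INR m * clifford_coef 0 m * z ^ m) (z * clifford 1 z)).
{ intros z; pose proof (is_series_euler _ _ z (clifford_decay 0)) as S.
  rewrite (PSeries_ext _ _ _ (clifford_derive_coef 0)) in S; exact S. }
assert (S0 : forall z, is_series (fun m => clifford_coef 0 m * z ^ m) (clifford 0 z))
  by (intros z; eapply is_series_PSeries, clifford_decay).
set (z := a * (a - x)); set (w := a ^ 2).
assert (S2 : is_series (fun m => / x * (gamma_coef a m * (w ^ m - z ^ m)))
  (/ x * - (bI 0 a * (w * clifford 1 w - z * clifford 1 z)
            - a * bI 1 a * (clifford 0 w - clifford 0 z)))).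
{ apply (is_series_scal_l (V := R_NormedModule) (/ x)).
  evar_last.
  - apply is_series_ext with (fun m => minus
      (scal (a * bI 1 a) (minus (clifford_coef 0 m * w ^ m) (clifford_coef 0 m * z ^ m)))
      (scal (bI 0 a) (minus (INR m * clifford_coef 0 m * w ^ m) (INR m * clifford_coef 0 m * z ^ m)))).
    { intros m; unfold gamma_coef, minus, opp, plus, scal; simpl; unfold mult; simpl; ring_R. }
    apply (is_series_minus (V := R_NormedModule));
      apply (is_series_scal_l (V := R_NormedModule));
      apply (is_series_minus (V := R_NormedModule)); auto.
  - unfold minus, opp, plus, scal; simpl; unfold mult; simpl; ring_R. }
replace (d a x) with (/ x * - (bI 0 a * (w * clifford 1 w - z * clifford 1 z)
            - a * bI 1 a * (clifford 0 w - clifford 0 z))).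
- revert S2; apply is_series_ext; intros m.
  replace (w ^ m - z ^ m) with (a ^ m * (x * pow_quotient a m x)).
  + transitivity ((/ x * x) * (gamma_coef a m * a ^ m * pow_quotient a m x)); [ring_R |].
    rewrite Rinv_l by lra; ring_R.
  + rewrite pow_quotient_eq; unfold w, z; rewrite Rpow_mult_distr, <- pow_mult.
    rewrite Nat.mul_comm, pow_mult; simpl; ring.
- apply Rmult_eq_reg_l with x; [| lra].
  rewrite <- Rmult_assoc, Rinv_r, Rmult_1_l, mult_x_d by lra.
  rewrite u_closed_form, u'_closed_form by lra.
  replace (bI 0 a) with (clifford 0 w) by (rewrite bI_clifford; unfold w; ring).
  rewrite bI_1_clifford; unfold z, w; ring.
Qed.

Lemma gamma_coef_le a m : 0 <= a ->
  Rabs (gamma_coef a m) <= (bI_bound a + a * bI_bound a) * (2 ^ m * / INR (fact m)).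
Proof.
intros Ha; unfold gamma_coef; rewrite Rabs_Ropp.
pose proof (bI_abs_le 0 a Ha) as B0; pose proof (bI_abs_le 1 a Ha) as B1.
pose proof (bI_bound_ge_0 a).
pose proof (clifford_decay 0 m) as Q; simpl (fact 0) in Q; simpl (INR 1) in Q.
rewrite Rinv_1 in Q; unfold Rdiv in Q; rewrite Rmult_1_l in Q.
pose proof (inv_fact_bounds m).
assert (Hm : INR m <= 2 ^ m /\ 1 <= 2 ^ m).
{ clear; induction m as [|m [IH IH']]; [simpl; lra |]; rewrite S_INR; simpl; lra. }
unfold Rminus; eapply Rle_trans; [apply Rabs_triang |].
rewrite Rabs_Ropp, !Rabs_mult, (Rabs_pos_eq a), (Rabs_pos_eq (INR m)) by (trivial; apply pos_INR).
replace ((bI_bound a + a * bI_bound a) * (2 ^ m * / INR (fact m)))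
  with (bI_bound a * (2 ^ m * / INR (fact m)) + a * bI_bound a * (2 ^ m * / INR (fact m))) by ring.
apply Rplus_le_compat; apply Rmult_le_compat; try apply Rabs_pos; try assumption.
- apply Rmult_le_pos; [apply pos_INR | apply Rabs_pos].
- apply Rmult_le_compat; try apply Rabs_pos; try apply pos_INR; [apply Hm | exact Q].
- apply Rmult_le_pos; [exact Ha | apply Rabs_pos].
- apply Rmult_le_compat_l; assumption.
- eapply Rle_trans; [exact Q |].
  rewrite <- (Rmult_1_l (/ INR (fact m))) at 1; apply Rmult_le_compat_r; [lra | apply Hm].
Qed.

(** Integrated term by term, [d_series] becomes the expression of
    [harmonic_wronskian] at [a^2]. *)
Lemma moment_d_0 a : 0 < a -> moment (d a) a 0 = - q a.
Proof.
intros Ha; assert (Ha' := Rlt_le _ _ Ha); rewrite moment_0.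
set (B := bI_bound a + a * bI_bound a).
assert (S1 : is_series (fun m => RInt (fun x => (gamma_coef a m * a ^ m) * pow_quotient a m x + 0 * 0) 0 a)
               (RInt (d a) 0 a)).
{ apply is_series_RInt with (fun m => B * ((4 * (a * (a + 1))) ^ m / INR (fact m))); [exact Ha' | | | | |].
  - intros m x; apply (continuous_lin (pow_quotient a m) (fun _ => 0));
      [apply pow_quotient_continuous | apply continuous_const].
  - intros x; eapply PSeries_continuous, d_decay, Ha'.
  - intros m x Hx; rewrite Rmult_0_l, Rplus_0_r, !Rabs_mult.
    rewrite (Rabs_pos_eq (a ^ m)) by (apply pow_le, Ha').
    replace (B * ((4 * (a * (a + 1))) ^ m / INR (fact m)))
      with ((B * (2 ^ m * / INR (fact m))) * a ^ m * (2 ^ m * (a + 1) ^ m)).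
    2: { replace (4 * (a * (a + 1))) with (2 * (2 * (a * (a + 1)))) by ring.
         rewrite !Rpow_mult_distr; unfold Rdiv; ring. }
    apply Rmult_le_compat; try apply Rabs_pos.
    + apply Rmult_le_pos; [apply Rabs_pos | apply pow_le, Ha'].
    + apply Rmult_le_compat_r; [apply pow_le, Ha' | apply gamma_coef_le, Ha'].
    + eapply Rle_trans; [apply pow_quotient_le; lra |].
      apply Rmult_le_compat_r; [apply pow_le; lra |].
      clear; induction m as [|m IH]; [simpl; lra |].
      rewrite S_INR; simpl; assert (1 <= 2 ^ m) by (apply pow_R1_Rle; lra); lra.
  - apply ex_series_exp_scal.
  - intros x Hx; apply is_series_ext with (2 := d_series a x Ha Hx).
    intros m; simpl; ring_R. }
assert (S2 : is_series (fun m => gamma_coef a m * a ^ m * (harmonic m * a ^ m))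
               (- (bI 0 a * (a ^ 2 * beta' (a ^ 2)) - a * bI 1 a * beta (a ^ 2)))).
{ evar_last.
  - apply is_series_ext with (fun m => minus
      (scal (a * bI 1 a) (beta_coef m * (a ^ 2) ^ m))
      (scal (bI 0 a) (INR m * beta_coef m * (a ^ 2) ^ m))).
    { intros m; unfold gamma_coef, beta_coef, minus, opp, plus, scal; simpl; unfold mult; simpl.
      rewrite !Rpow_mult_distr, pow1; ring_R. }
    apply (is_series_minus (V := R_NormedModule));
      apply (is_series_scal_l (V := R_NormedModule)).
    + eapply is_series_PSeries, beta_decay.
    + eapply is_series_euler, beta_decay.
  - unfold beta, beta', minus, opp, plus, scal; simpl; unfold mult; simpl; ring_R. }
assert (E : RInt (d a) 0 a = - (bI 0 a * (a ^ 2 * beta' (a ^ 2)) - a * bI 1 a * beta (a ^ 2))).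
{ rewrite <- (is_series_unique _ _ S1), <- (is_series_unique _ _ S2).
  apply Series_ext; intros m.
  rewrite RInt_lin.
  - rewrite RInt_pow_quotient; ring_R.
  - intros x; apply pow_quotient_continuous.
  - intros x; apply continuous_const. }
pose proof (harmonic_wronskian (a ^ 2)) as Hw.
unfold q; fold (bI 0 a).
assert (B0 : bI 0 a = clifford 0 (a ^ 2)) by (rewrite bI_clifford; simpl pow; ring).
transitivity (- (a ^ 2 * (clifford 0 (a ^ 2) * beta' (a ^ 2) - clifford 1 (a ^ 2) * beta (a ^ 2)))).
- etransitivity; [exact E |]; rewrite bI_1_clifford, B0; ring.
- rewrite Hw, B0; field.
Qed.

(** * The solutions of the integral equations *)

Lemma sign_square_abs (eps : R) : eps = 1 \/ eps = -1 -> eps * eps = 1 /\ Rabs eps = 1.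
Proof. intros [-> | ->]; split; try ring; [apply Rabs_R1 | rewrite Rabs_left; lra]. Qed.

(** The two signs are handled together; [pq eps] increases since its derivative
    is the square of [bI 0 - eps * bI 1]. *)
Definition pq (eps a : R) : R := p a - eps * q a.

Lemma p_derive a : is_derive p a (bI 0 a ^ 2 + bI 1 a ^ 2).
Proof.
unfold p; evar_last.
{ apply (is_derive_mult (fun a => a) (fun a => bI 0 a ^ 2 - bI 1 a ^ 2));
    [apply (is_derive_id (K := R_AbsRing)) | | exact Rmult_comm].
  apply (is_derive_minus (V := R_NormedModule)); apply is_derive_pow;
    [apply bI_0_derive | apply bI_1_derive]. }
rewrite bI_1_clifford; set (c := clifford 1 (a ^ 2)).
unfold minus, opp, plus, mult, one; simpl; unfold plus; simpl; ring.
Qed.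

Lemma q_derive a : is_derive q a (2 * bI 0 a * bI 1 a).
Proof.
unfold q; evar_last.
{ apply is_derive_scal; apply (is_derive_minus (V := R_NormedModule) (fun a => bI 0 a ^ 2));
    [apply is_derive_pow, bI_0_derive | apply is_derive_const]. }
unfold minus, opp, plus, zero; simpl; field.
Qed.

Lemma pq_derive eps a : eps * eps = 1 ->
  is_derive (pq eps) a ((bI 0 a - eps * bI 1 a) ^ 2).
Proof.
intros He; evar_last.
{ apply (is_derive_minus (V := R_NormedModule)); [apply p_derive |].
  apply is_derive_scal, q_derive. }
unfold minus, opp, plus; simpl.
replace (bI 1 a * (bI 1 a * 1)) with ((eps * eps) * (bI 1 a * bI 1 a)) by (rewrite He; ring).
ring.
Qed.

Lemma pq_at_0 eps : pq eps 0 = 0.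
Proof. unfold pq, p, q; fold (bI 0 0); rewrite bI_0_at_0; field. Qed.

Lemma pq_le eps a b : eps * eps = 1 -> a <= b -> pq eps a <= pq eps b.
Proof.
intros He Hab.
apply (increasing_le _ (fun x => (bI 0 x - eps * bI 1 x) ^ 2)); [exact Hab | |].
- intros x _; apply pq_derive, He.
- intros x _; apply pow2_ge_0.
Qed.

Lemma bI_sub_ge eps a : eps = 1 \/ eps = -1 -> 0 <= a -> a / 4 <= bI 0 a - eps * bI 1 a.
Proof.
intros He Ha; pose proof (bI_0_minus_1_gt a Ha); pose proof (bI_1_ge_0 a Ha).
destruct He as [-> | ->]; lra.
Qed.

Lemma pq_ge eps a : eps = 1 \/ eps = -1 -> 0 <= a -> a ^ 3 / 48 <= pq eps a.
Proof.
intros He Ha; destruct (sign_square_abs eps He) as [He2 _].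
assert (H : pq eps 0 - 0 ^ 3 / 48 <= pq eps a - a ^ 3 / 48).
{ apply (increasing_le (fun x => pq eps x - x ^ 3 / 48)
    (fun x => (bI 0 x - eps * bI 1 x) ^ 2 - x ^ 2 / 16)); [exact Ha | |].
  - intros x _; apply (is_derive_minus (V := R_NormedModule)); [apply pq_derive, He2 |].
    auto_derive; [trivial | field].
  - intros x Hx; pose proof (bI_sub_ge eps x He (proj1 Hx)); nra. }
rewrite pq_at_0 in H; lra.
Qed.

Lemma pq_pos eps a : eps = 1 \/ eps = -1 -> 0 < a -> 0 < pq eps a.
Proof.
intros He Ha; pose proof (pq_ge eps a He (Rlt_le _ _ Ha)).
assert (0 < a ^ 3) by (apply pow_lt, Ha); lra.
Qed.

(** [u + eps u'] solves the equation of the kernel [J_0 (2 sqrt (x y))]; adding a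
    multiple of [s + eps d] changes its right-hand side by a constant, which [L]
    kills.  [psi_factor] gives [psi] the integral [eps] over [(0,a)], which makes
    the mean value subtracted by [moment_L] fit the right-hand side. *)
Definition psi_factor (eps a : R) : R := (eps * bI 0 a - bI 1 a) / pq eps a.

Definition psi_coef (eps a : R) (n : nat) : R :=
  1 * (1 * u_coef a n + eps * PS_derive (u_coef a) n)
  + psi_factor eps a * (1 * s_coef a n + eps * d_coef a n).

Definition solution (eps a : R) : R -> R := PSeries (L_coef (psi_coef eps a)).

Lemma psi_decay eps a : 0 <= a -> exists C, fact_decay C (psi_coef eps a).
Proof.
intros Ha; destruct (s_decay a Ha) as [C HC]; eexists.
apply fact_decay_lin; apply fact_decay_lin;
  [apply u_decay | apply u'_decay | exact HC | apply d_decay]; exact Ha.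
Qed.

Lemma PSeries_psi eps a x : 0 <= a -> PSeries (psi_coef eps a) x
  = 1 * (1 * u a x + eps * u' a x) + psi_factor eps a * (1 * s a x + eps * d a x).
Proof.
intros Ha; destruct (s_decay a Ha) as [C HC].
pose proof (u_decay a Ha) as Hu; pose proof (u'_decay a Ha) as Hu'; pose proof (d_decay a Ha) as Hd.
unfold psi_coef.
rewrite (PSeries_lin _ _ _ _ _ _ _ (fact_decay_lin _ _ _ _ _ _ Hu Hu')
                                   (fact_decay_lin _ _ _ _ _ _ HC Hd)).
rewrite (PSeries_lin _ _ _ _ _ _ _ Hu Hu'), (PSeries_lin _ _ _ _ _ _ _ HC Hd).
reflexivity.
Qed.

Lemma moment_psi eps a n : 0 < a -> moment (PSeries (psi_coef eps a)) a n
  = (INR (fact n) * bI (S n) a + eps * (a ^ n - INR (fact n) * bI n a))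
    + psi_factor eps a * (moment (s a) a n + eps * moment (d a) a n).
Proof.
intros Ha; assert (Ha' := Rlt_le _ _ Ha); destruct (s_decay a Ha') as [C HC].
destruct (moments_u_u' a n Ha) as [<- <-].
assert (Cu := fun x => u_continuous a x Ha'); assert (Cu' := fun x => u'_continuous a x Ha').
assert (Cs : forall x, continuous (s a) x) by (intros; eapply PSeries_continuous, HC).
assert (Cd : forall x, continuous (d a) x) by (intros; eapply PSeries_continuous, d_decay, Ha').
transitivity (moment (fun x => 1 * (1 * u a x + eps * u' a x)
                               + psi_factor eps a * (1 * s a x + eps * d a x)) a n).
- apply RInt_ext_R; intros x; rewrite PSeries_psi by exact Ha'; reflexivity.
- rewrite (moment_lin (fun x => 1 * u a x + eps * u' a x) (fun x => 1 * s a x + eps * d a x))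
    by (intros; apply continuous_lin; auto).
  rewrite !moment_lin by auto; ring.
Qed.

Lemma moment_psi_0 eps a : eps = 1 \/ eps = -1 -> 0 < a ->
  moment (PSeries (psi_coef eps a)) a 0 = eps.
Proof.
intros He Ha; rewrite moment_psi, moment_d_0 by exact Ha.
pose proof (moment_s a 0 Ha) as Hs; simpl (INR 1) in Hs; simpl (fact 0) in *.
rewrite Rmult_1_l in Hs; rewrite Hs.
pose proof (pq_pos eps a He Ha) as Hd.
assert (E : a * INR 1 * (bI 0 a * bI 0 a - bI 1 a * bI 1 a) + eps * - q a = pq eps a).
{ unfold pq, p; fold (bI 0 a) (bI 1 a); simpl; ring. }
rewrite E; unfold psi_factor; simpl; field; lra.
Qed.

Lemma solution_is_phi eps a : eps = 1 \/ eps = -1 -> 0 < a ->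
  is_phi_diamond eps a (solution eps a).
Proof.
intros He Ha; assert (Ha' := Rlt_le _ _ Ha).
destruct (sign_square_abs eps He) as [He2 _].
destruct (psi_decay eps a Ha') as [C HC].
pose proof (L_decay _ _ HC) as HL.
assert (Cf : forall x, continuous (solution eps a) x)
  by (intros x; eapply PSeries_continuous, HL).
split; [exact Cf |]; intros x.
destruct (fact_decay_k_moments _ a Ha' Cf) as [D HD].
rewrite RInt_k_diamond by assumption.
rewrite <- (Rmult_1_l (solution eps a x)); unfold solution at 1.
rewrite <- (PSeries_lin _ _ _ _ 1 eps x HL HD), k_diamond_dilate.
apply PSeries_ext; intros n.
pose proof (moment_L _ _ a n HC) as M; rewrite moment_psi_0 in M by assumption.
rewrite moment_psi in M by exact Ha.
fold (solution eps a) in M.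
destruct n as [|n].
- unfold L_coef, k_coef; simpl; field.
- pose proof (moment_s a (S n) Ha) as Ms; pose proof (moment_d a n Ha) as Md.
  unfold L_coef, psi_coef, d_coef, d_rhs_coef, avg, s_coef, s_tail, s_rhs_coef.
  rewrite u'_coef; unfold u_coef, k_coef.
  pose proof (pos_INR n) as Hn; pose proof (INR_fact_lt_0 (S n)) as Hf.
  assert (HN : INR (S n) <> 0) by (apply not_0_INR; lia).
  assert (HN2 : INR (S (S n)) <> 0) by (apply not_0_INR; lia).
  assert (Es : moment (s a) a (S n)
    = a * INR (fact (S n)) * (bI 0 a * bI (S n) a - bI 1 a * bI (S (S n)) a) / INR (S (S n)))
    by (rewrite <- Ms; field; exact HN2).
  assert (Ed : moment (d a) a (S n)
    = a * INR (fact (S n)) * (bI 0 a * bI (S (S n)) a - bI 1 a * bI (S n) a) / INR (S n))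
    by (rewrite <- Md; field; exact HN).
  rewrite Es, Ed in M.
  rewrite Nat.add_1_r, (fact_simpl (S n)), mult_INR.
  set (k := INR (S n)) in *; set (k2 := INR (S (S n))) in *; set (F := INR (fact (S n))) in *.
  set (c := psi_factor eps a) in *; set (mu := moment (solution eps a) a (S n)) in *.
  set (i0 := bI 0 a) in *; set (i1 := bI 1 a) in *.
  set (in1 := bI (S n) a) in *; set (in2 := bI (S (S n)) a) in *.
  set (sg := (-1) ^ S n) in *; set (an := a ^ S n) in *.
  assert (Emu : mu = k2 / k * (F * in2 + eps * (an - F * in1)
      + c * (a * F * (i0 * in1 - i1 * in2) / k2 + eps * (a * F * (i0 * in2 - i1 * in1) / k))
      - an / k2 * eps)).
  { rewrite <- M; field; split; assumption. }
  rewrite Emu.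
  assert (Hk : k2 = k + 1) by apply S_INR.
  rewrite Hk in HN2; rewrite Hk.
  destruct He as [-> | ->]; field; repeat split; (assumption || lra).
Qed.

(** The constant term of [psi_coef], which is not controlled as [a] varies, is
    killed by [L]; and [pq] is increasing. *)
Lemma solution_bounded eps a t : eps = 1 \/ eps = -1 -> 0 < t <= a ->
  exists M, forall b y, t <= b <= a -> 0 <= y <= a -> Rabs (solution eps b y) <= M.
Proof.
intros He Ht; destruct (sign_square_abs eps He) as [He2 Hea].
set (B := bI_bound a); set (R0 := rhs_bound a).
set (K := 2 * B / pq eps t).
exists ((2 * B + K * (2 * R0)) * exp a); intros b y Hb Hy.
assert (Hbound : bI_bound b <= B).
{ unfold B, bI_bound; apply Rmult_le_compat; try apply Rlt_le, exp_pos.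
  - destruct (Rle_lt_or_eq_dec b a (proj2 Hb)) as [H| ->]; [apply Rlt_le, exp_increasing, H | lra].
  - assert (b ^ 2 <= a ^ 2) by nra.
    destruct (Rle_lt_or_eq_dec _ _ H) as [H'|H']; [apply Rlt_le, exp_increasing, H' | rewrite H'; lra]. }
pose proof (bI_bound_ge_0 b) as Hb0.
assert (Hrhs : rhs_bound b <= R0).
{ unfold R0, rhs_bound; apply Rmult_le_compat_l; [lra |].
  apply Rmult_le_compat; try lra; [apply Rmult_le_pos; lra |].
  apply Rmult_le_compat; fold B; lra. }
assert (HdP : 0 < pq eps t) by (apply pq_pos; [exact He | lra]).
assert (HdL : pq eps t <= pq eps b) by (apply pq_le; [exact He2 | lra]).
assert (Hb' : 0 <= b) by lra.
pose proof (rhs_bound_ge_0 b Hb') as HR0.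
assert (Hfac : Rabs (psi_factor eps b) <= K).
{ unfold psi_factor, K, Rdiv; rewrite Rabs_mult.
  apply Rmult_le_compat; try apply Rabs_pos.
  - unfold Rminus; eapply Rle_trans; [apply Rabs_triang |].
    rewrite Rabs_Ropp, Rabs_mult, Hea.
    pose proof (bI_abs_le 0 b Hb'); pose proof (bI_abs_le 1 b Hb'); lra.
  - rewrite Rabs_pos_eq by (apply Rlt_le, Rinv_0_lt_compat; lra).
    apply Rinv_le_contravar; assumption. }
assert (HD : fact_decay (2 * B + K * (2 * R0)) (L_coef (psi_coef eps b))).
{ intros n; pose proof (inv_fact_bounds n) as Hn.
  assert (HB : 0 <= B) by lra.
  assert (HK : 0 <= K) by (eapply Rle_trans; [apply Rabs_pos | exact Hfac]).
  assert (HKR : 0 <= K * (2 * R0)) by (apply Rmult_le_pos; lra).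
  assert (Hdiv : forall x y, x <= y -> x / INR (fact n) <= y / INR (fact n))
    by (intros; apply Rmult_le_compat_r; lra).
  destruct n as [|n].
  { unfold L_coef; simpl INR; unfold Rdiv; rewrite Rmult_0_l, Rmult_0_l, Rabs_R0, Rinv_1; lra. }
  unfold L_coef; rewrite Rabs_mult.
  assert (HL : Rabs (INR (S n) / INR (S (S n))) <= 1).
  { pose proof (pos_INR (S n)); rewrite (S_INR (S n)).
    rewrite Rabs_pos_eq; [| apply Rmult_le_pos; [lra | apply Rlt_le, Rinv_0_lt_compat; lra]].
    apply Rmult_le_reg_r with (INR (S n) + 1); [lra |].
    unfold Rdiv; rewrite Rmult_assoc, Rinv_l; lra. }
  rewrite <- (Rmult_1_l (_ / INR (fact (S n)))).
  apply Rmult_le_compat; try apply Rabs_pos; [exact HL |].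
  unfold psi_coef; rewrite Rmult_1_l, !Rmult_1_l.
  eapply Rle_trans; [apply Rabs_triang |].
  unfold Rdiv; rewrite Rmult_plus_distr_r; apply Rplus_le_compat.
  - eapply Rle_trans; [apply Rabs_triang |]; rewrite Rabs_mult, Hea.
    pose proof (u_decay b Hb' (S n)); pose proof (u'_decay b Hb' (S n)).
    pose proof (Hdiv _ _ Hbound); unfold Rdiv in *; lra.
  - rewrite Rabs_mult, Rmult_assoc; apply Rmult_le_compat; try apply Rabs_pos; [exact Hfac |].
    eapply Rle_trans; [apply Rabs_triang |]; rewrite Rabs_mult, Hea.
    pose proof (s_tail_decay b Hb' (S n)) as H1; pose proof (d_decay b Hb' (S n)) as H2.
    rewrite !Rmult_1_l in H1, H2.
    pose proof (Hdiv _ _ Hrhs); unfold Rdiv in *; simpl (s_coef b (S n)); lra. }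
eapply Rle_trans; [eapply PSeries_abs_le, HD |].
rewrite (Rabs_pos_eq y) by lra.
apply Rmult_le_compat_l; [eapply fact_decay_const_ge_0, HD |].
destruct (Rle_lt_or_eq_dec y a (proj2 Hy)) as [H| ->]; [apply Rlt_le, exp_increasing, H | lra].
Qed.

Lemma phi_diamond_eq eps a x : eps = 1 \/ eps = -1 -> 0 < a ->
  phi_diamond eps a x = solution eps a x.
Proof.
intros He Ha; destruct (sign_square_abs eps He) as [He2 _].
pose proof (solution_is_phi eps a He Ha) as [Cs Es].
assert (Hphi : is_phi_diamond eps a (phi_diamond eps a)).
{ unfold phi_diamond; apply epsilon_spec; exists (solution eps a); split; assumption. }
destruct Hphi as [Cp Ep].
assert (E : 1 * phi_diamond eps a x + (-1) * solution eps a x = 0).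
{ apply (null_solution_zero eps a (solution eps)
           (fun x => 1 * phi_diamond eps a x + (-1) * solution eps a x)); try assumption.
  - intros b Hb; apply solution_is_phi; assumption.
  - intros t Ht; apply solution_bounded; assumption.
  - intros y; apply continuous_lin; auto.
  - intros y.
    rewrite (RInt_ext_R _ (fun z => 1 * (k_diamond (y * z) * phi_diamond eps a z)
                                    + (-1) * (k_diamond (y * z) * solution eps a z)))
      by (intros; ring).
    rewrite RInt_lin by (intros; apply continuous_mult_R; auto using k_diamond_cont).
    specialize (Es y); specialize (Ep y); lra. }
lra.
Qed.

Lemma solution_at_a eps a : eps = 1 \/ eps = -1 -> 0 < a ->
  solution eps a a
  = 1 - eps * a - eps / a + eps * ((bI 0 a - eps * bI 1 a) ^ 2 / pq eps a).
Proof.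
intros He Ha; destruct (psi_decay eps a (Rlt_le _ _ Ha)) as [C HC].
pose proof (avg_at _ _ a HC) as A; rewrite moment_psi_0 in A by assumption.
unfold solution; rewrite (PSeries_L _ _ _ HC), PSeries_psi by lra.
replace (PSeries (avg (psi_coef eps a)) a) with (eps / a) by (apply Rmult_eq_reg_l with a; [rewrite A; field |]; lra).
rewrite u_at_a, u'_at_a, d_at_a, s_at_a by lra.
pose proof (pq_pos eps a He Ha).
unfold psi_factor; destruct He as [-> | ->]; field; lra.
Qed.

Lemma mu_diamond_closed_form a : 0 < a ->
  mu_diamond a = 2 * a + a * ((bI 0 a - bI 1 a) ^ 2 / (p a - q a)
                              - (bI 0 a + bI 1 a) ^ 2 / (p a + q a)).
Proof.
intros Ha; unfold mu_diamond.
rewrite !phi_diamond_eq, !solution_at_a by (lra || tauto).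
unfold pq.
replace (p a - 1 * q a) with (p a - q a) by ring.
replace (p a - -1 * q a) with (p a + q a) by ring.
replace (bI 0 a - 1 * bI 1 a) with (bI 0 a - bI 1 a) by ring.
replace (bI 0 a - -1 * bI 1 a) with (bI 0 a + bI 1 a) by ring.
field.
pose proof (pq_pos 1 a (or_introl eq_refl) Ha) as H1.
pose proof (pq_pos (-1) a (or_intror eq_refl) Ha) as H2.
unfold pq in *; lra.
Qed.

Lemma log_derivative_ratio (f g : R -> R) x df dg :
  is_derive f x df -> is_derive g x dg -> 0 < f x -> 0 < g x ->
  Derive (fun t => ln (f t / g t)) x = df / f x - dg / g x.
Proof.
intros Hf Hg Hf0 Hg0; apply is_derive_unique.
assert (0 < f x / g x) by (apply Rdiv_lt_0_compat; assumption).
evar_last.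
{ apply (is_derive_comp ln (fun t => f t / g t)); [apply is_derive_ln; assumption |].
  apply is_derive_div; [exact Hf | exact Hg | lra]. }
unfold scal; simpl; unfold mult; simpl; field; lra.
Qed.

Lemma mu_diamond_log_derivative a : 0 < a ->
  mu_diamond a = 2 * a + a * Derive (fun t => ln ((p t - q t) / (p t + q t))) a.
Proof.
intros Ha; rewrite mu_diamond_closed_form by exact Ha.
f_equal; f_equal; symmetry.
apply (log_derivative_ratio (fun t => p t - q t) (fun t => p t + q t)).
- evar_last; [apply (is_derive_minus (V := R_NormedModule)); [apply p_derive | apply q_derive] |].
  unfold minus, opp, plus; simpl; ring.
- evar_last; [apply (is_derive_plus (V := R_NormedModule)); [apply p_derive | apply q_derive] |].
  unfold plus; simpl; ring.
- pose proof (pq_pos 1 a (or_introl eq_refl) Ha) as H1; unfold pq in H1; lra.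
- pose proof (pq_pos (-1) a (or_intror eq_refl) Ha) as H2; unfold pq in H2; lra.
Qed.

(** * Asymptotics *)

Lemma bI_1_derive' x : 0 < x -> is_derive (bI 1) x (2 * bI 0 x - bI 1 x / x).
Proof.
intros Hx; evar_last; [apply bI_1_derive |].
rewrite bI_1_clifford; field; lra.
Qed.

(** [exp K * y] is nondecreasing, and dividing it by the nondecreasing [exp K]
    can only bring a negative value closer to [0]. *)
Lemma damped_bounded_below (y dy K dK : R -> R) A x : A <= x ->
  (forall t, A <= t <= x -> is_derive y t (dy t)) ->
  (forall t, A <= t <= x -> is_derive K t (dK t)) ->
  (forall t, A <= t <= x -> 0 <= dK t) ->
  (forall t, A <= t <= x -> 0 <= dy t + dK t * y t) ->
  - Rabs (y A) <= y x.
Proof.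
intros HAx Hy HK HdK Hineq.
assert (H1 : K A <= K x) by (apply (increasing_le K dK); assumption).
assert (H2 : exp (K A) * y A <= exp (K x) * y x).
{ apply (increasing_le (fun t => exp (K t) * y t) (fun t => exp (K t) * (dy t + dK t * y t)));
    [exact HAx | |].
  - intros t Ht; evar_last.
    { apply (is_derive_mult (fun t => exp (K t)) y); [| apply Hy, Ht | exact Rmult_comm].
      apply (is_derive_comp exp K); [apply is_derive_exp | apply HK, Ht]. }
    unfold plus, scal, mult; simpl; unfold mult; simpl; ring.
  - intros t Ht; apply Rmult_le_pos; [apply Rlt_le, exp_pos | apply Hineq, Ht]. }
assert (H3 : exp (K A) <= exp (K x)).
{ destruct H1 as [H1| ->]; [apply Rlt_le, exp_increasing, H1 | lra]. }
pose proof (exp_pos (K A)); pose proof (exp_pos (K x)).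
pose proof (Rabs_pos (y A)); pose proof (Rle_abs (- y A)) as Habs; rewrite Rabs_Ropp in Habs.
apply Rmult_le_reg_l with (exp (K x)); [assumption |].
nra.
Qed.

Definition bI_defect (a : R) : R := bI 0 a - (4 * a - / 2) * (bI 0 a - bI 1 a).

Lemma bI_gap_derive x : 0 < x -> is_derive (fun a => bI 0 a - bI 1 a) x
  (2 * (bI 0 x - bI 1 x) - 3 / (2 * x) * (bI 0 x - bI 1 x) + bI_defect x / x).
Proof.
intros Hx; evar_last.
{ apply (is_derive_minus (V := R_NormedModule)); [apply bI_0_derive | apply bI_1_derive', Hx]. }
unfold bI_defect, minus, opp, plus; simpl; field; lra.
Qed.

Lemma bI_defect_derive x : 0 < x -> is_derive bI_defect x
  (- (2 - / (2 * x)) * bI_defect x - 3 / (4 * x) * (bI 0 x - bI 1 x)).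
Proof.
intros Hx; evar_last.
{ apply (is_derive_minus (V := R_NormedModule)); [apply bI_0_derive |].
  apply (is_derive_mult (fun a => 4 * a - / 2) (fun a => bI 0 a - bI 1 a));
    [| apply bI_gap_derive, Hx | exact Rmult_comm].
  evar_last; [auto_derive; [trivial |] |]; reflexivity. }
unfold bI_defect, minus, opp, plus, mult; simpl; field; lra.
Qed.

(** The equation of [bI_defect] damps it while forcing it with [I_0 - I_1] divided
    by [a]; the correction [(I_0 - I_1) / a] overcompensates this forcing. *)
Lemma bI_defect_bounds : exists C, 0 <= C /\ forall x, 2 <= x ->
  Rabs (bI_defect x) <= C + (bI 0 x - bI 1 x) / x.
Proof.
set (y2 := fun x => bI_defect x + (bI 0 x - bI 1 x) / x).
exists (Rabs (bI_defect 2) + Rabs (y2 2)).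
split; [apply Rplus_le_le_0_compat; apply Rabs_pos |].
intros x Hx.
assert (gap : forall t, 2 <= t -> 0 < bI 0 t - bI 1 t).
{ intros t Ht; pose proof (bI_0_minus_1_gt t); lra. }
assert (Hi : forall t, 2 <= t -> 0 < / t <= / 2).
{ intros t Ht; split; [apply Rinv_0_lt_compat; lra | apply Rinv_le_contravar; lra]. }
assert (Hup : bI_defect x <= Rabs (bI_defect 2)).
{ enough (- Rabs (- bI_defect 2) <= - bI_defect x) by (rewrite Rabs_Ropp in *; lra).
  apply (damped_bounded_below (fun t => - bI_defect t)
    (fun t => - (- (2 - / (2 * t)) * bI_defect t - 3 / (4 * t) * (bI 0 t - bI 1 t)))
    (fun t => 2 * t - ln t / 2) (fun t => 2 - / (2 * t))); [exact Hx | | | |]; intros t Ht.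
  - apply (is_derive_opp (V := R_NormedModule) bI_defect), bI_defect_derive; lra.
  - auto_derive; [lra | field; lra].
  - specialize (Hi t (proj1 Ht)); rewrite Rinv_mult; lra.
  - replace (_ + _) with (3 / 4 * (/ t * (bI 0 t - bI 1 t))) by (field; lra).
    specialize (gap t (proj1 Ht)); specialize (Hi t (proj1 Ht)).
    apply Rmult_le_pos; [lra |]; apply Rmult_le_pos; lra. }
assert (Hlow : - Rabs (y2 2) <= y2 x).
{ apply (damped_bounded_below y2
    (fun t => (- (2 - / (2 * t)) * bI_defect t - 3 / (4 * t) * (bI 0 t - bI 1 t))
       + ((2 * (bI 0 t - bI 1 t) - 3 / (2 * t) * (bI 0 t - bI 1 t) + bI_defect t / t) * t
          - (bI 0 t - bI 1 t) * 1) / t ^ 2)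
    (fun t => 2 * t - ln t / 2 + / t) (fun t => 2 - / (2 * t) - / t ^ 2));
    [exact Hx | | | |]; intros t Ht.
  - apply (is_derive_plus (V := R_NormedModule) bI_defect); [apply bI_defect_derive; lra |].
    apply (is_derive_div (fun t => bI 0 t - bI 1 t) (fun t => t));
      [apply bI_gap_derive; lra | apply (is_derive_id (K := R_AbsRing)) | lra].
  - auto_derive; [lra | field; lra].
  - specialize (Hi t (proj1 Ht)); rewrite Rinv_mult, <- pow_inv; nra.
  - unfold y2.
    replace (_ + _) with ((bI 0 t - bI 1 t) * / t * (13 / 4 - 3 * / t - (/ t) ^ 2))
      by (field; lra).
    specialize (gap t (proj1 Ht)); specialize (Hi t (proj1 Ht)).
    apply Rmult_le_pos; [apply Rmult_le_pos; lra | nra]. }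
assert (0 <= (bI 0 x - bI 1 x) / x).
{ specialize (gap x Hx); specialize (Hi x Hx); apply Rmult_le_pos; lra. }
pose proof (Rabs_pos (bI_defect 2)); pose proof (Rabs_pos (y2 2)).
unfold y2 at 2 in Hlow.
apply Rabs_le; lra.
Qed.

(** Divide the bounds of [bI_defect] by [I_0 - I_1], which exceeds [a / 4].  The
    result says that [I_1 / I_0 = 1 - 1 / (4 a) - 1 / (32 a^2) + O(a^-3)]. *)
Lemma bI_ratio_asymptotics : exists C, 0 <= C /\ forall x, 2 <= x ->
  Rabs (bI 0 x / (bI 0 x - bI 1 x) - (4 * x - / 2)) <= C / x.
Proof.
destruct bI_defect_bounds as [C [HC0 HC]].
exists (4 * C + 1); split; [lra |]; intros x Hx.
pose proof (bI_0_minus_1_gt x) as Hgap.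
set (e := bI 0 x - bI 1 x) in *.
assert (He : x / 4 < e) by (apply Hgap; lra).
assert (He0 : 0 < e) by lra.
replace (bI 0 x / e - (4 * x - / 2)) with (bI_defect x * / e)
  by (unfold bI_defect; fold e; field; lra).
rewrite Rabs_mult, (Rabs_pos_eq (/ e)) by (apply Rlt_le, Rinv_0_lt_compat, He0).
apply Rmult_le_reg_r with e; [exact He0 |].
rewrite Rmult_assoc, Rinv_l, Rmult_1_r by lra.
eapply Rle_trans; [apply HC, Hx |]; fold e.
replace ((4 * C + 1) / x * e) with (C * (4 * e * / x) + e / x) by (field; lra).
apply Rplus_le_compat_r.
rewrite <- (Rmult_1_r C) at 1; apply Rmult_le_compat_l; [exact HC0 |].
apply Rmult_le_reg_r with x; [lra |].
rewrite Rmult_assoc, Rinv_l by lra; lra.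
Qed.

Lemma is_lim_0_of_bound (f : R -> R) C A :
  (forall x, A <= x -> Rabs (f x) <= C / x) -> is_lim f p_infty 0.
Proof.
intros H.
assert (L : forall k, is_lim (fun x => k / x) p_infty 0).
{ intros k; unfold Rdiv; evar_last;
    [apply is_lim_scal_l, (is_lim_inv (fun x => x) p_infty p_infty); [apply is_lim_id | discriminate] |].
  simpl; f_equal; ring. }
apply (is_lim_le_le_loc (fun x => - C / x) (fun x => C / x)); [| apply L | apply L].
exists A; intros x Hx; specialize (H x (Rlt_le _ _ Hx)).
apply Rabs_le_between in H; unfold Rdiv in *; lra.
Qed.

(** For large arguments both [(eps / 2) T + E] and [(eps / 2) T - E] are
    nondecreasing, so [|E|] exceeds [(eps / 2) T] by at most a constant. *)
Lemma little_o_of_derive (E T T' eta : R -> R) A :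
  (forall x, A <= x -> is_derive T x (T' x)) ->
  (forall x, A <= x -> is_derive E x (eta x * T' x)) ->
  (forall x, A <= x -> 0 <= T' x) ->
  is_lim T p_infty p_infty -> is_lim eta p_infty 0 ->
  is_lim (fun x => E x / T x) p_infty 0.
Proof.
intros HT HE HT' LT Leta.
apply is_lim_spec; intros eps.
apply is_lim_spec in LT; apply is_lim_spec in Leta.
assert (Heps : 0 < eps / 2) by (pose proof (cond_pos eps); lra).
destruct (Leta (mkposreal _ Heps)) as [B1 HB1]; simpl in HB1.
destruct (LT 0) as [B2 HB2].
set (B := Rmax A (Rmax B1 B2) + 1).
assert (HB : A < B /\ B1 < B /\ B2 < B).
{ unfold B; pose proof (Rmax_l A (Rmax B1 B2)); pose proof (Rmax_r A (Rmax B1 B2)).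
  pose proof (Rmax_l B1 B2); pose proof (Rmax_r B1 B2); lra. }
destruct (LT (2 * Rabs (E B) / eps)) as [B3 HB3].
exists (Rmax B B3); intros x Hx.
assert (Hx1 : B < x) by (eapply Rle_lt_trans; [apply Rmax_l | exact Hx]).
assert (Hx2 : B3 < x) by (eapply Rle_lt_trans; [apply Rmax_r | exact Hx]).
specialize (HB3 x Hx2).
assert (TB : 0 < T B) by (apply HB2; lra).
assert (Tx : 0 < T x) by (apply HB2; lra).
assert (Hsign : forall sg, Rabs sg = 1 ->
          eps / 2 * T B + sg * E B <= eps / 2 * T x + sg * E x).
{ intros sg Hsg.
  apply (increasing_le (fun t => eps / 2 * T t + sg * E t)
    (fun t => eps / 2 * T' t + sg * (eta t * T' t))); [lra | |]; intros t Ht.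
  - apply (is_derive_plus (V := R_NormedModule) (fun t => eps / 2 * T t) (fun t => sg * E t));
      apply is_derive_scal; [apply HT | apply HE]; lra.
  - replace (eps / 2 * T' t + sg * (eta t * T' t)) with ((eps / 2 + sg * eta t) * T' t) by ring.
    apply Rmult_le_pos; [| apply HT'; lra].
    assert (Rabs (sg * eta t) < eps / 2).
    { rewrite Rabs_mult, Hsg, Rmult_1_l; rewrite <- (Rminus_0_r (eta t)); apply HB1; lra. }
    apply Rabs_def2 in H; lra. }
pose proof (Hsign 1 Rabs_R1) as S1.
assert (S2 : eps / 2 * T B + -1 * E B <= eps / 2 * T x + -1 * E x)
  by (apply Hsign; rewrite Rabs_left; lra).
assert (HEB : Rabs (E B) < eps / 2 * T x).
{ apply Rmult_lt_reg_r with (2 / eps); [apply Rdiv_lt_0_compat; [lra | apply cond_pos] |].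
  pose proof (cond_pos eps).
  replace (eps / 2 * T x * (2 / eps)) with (T x) by (field; lra).
  replace (Rabs (E B) * (2 / eps)) with (2 * Rabs (E B) / eps) by (field; lra).
  exact HB3. }
pose proof (Rle_abs (E B)); pose proof (Rle_abs (- E B)) as H0; rewrite Rabs_Ropp in H0.
rewrite Rminus_0_r; unfold Rdiv; rewrite Rabs_mult, (Rabs_pos_eq (/ T x))
  by (apply Rlt_le, Rinv_0_lt_compat, Tx).
apply Rmult_lt_reg_r with (T x); [exact Tx |].
rewrite Rmult_assoc, Rinv_l, Rmult_1_r by lra.
assert (0 < eps / 2 * T B) by (apply Rmult_lt_0_compat; assumption).
apply Rabs_def1; lra.
Qed.

(** In the manner of l'Hospital's rule: comparing [T' - 4 T] with [T] gives
    [T' / T -> 4], and with this the derivative of [x T' - (4 x - k) T] is [o(T')]. *)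
Lemma log_derivative_asymptotics (T T' T'' : R -> R) A k :
  (forall x, A <= x -> is_derive T x (T' x)) ->
  (forall x, A <= x -> is_derive T' x (T'' x)) ->
  (forall x, A <= x -> 0 < T' x) ->
  is_lim T p_infty p_infty ->
  is_lim (fun x => x * T'' x / T' x - 4 * x + k) p_infty 0 ->
  is_lim (fun x => x * T' x / T x - 4 * x + k) p_infty 0.
Proof.
intros HT HT' Tpos LT L2.
set (h := fun x => x * T'' x / T' x - 4 * x + k) in *.
assert (Linv : forall c, is_lim (fun x => c / x) p_infty 0).
{ intros c; apply is_lim_0_of_bound with (Rabs c) 1; intros x Hx.
  unfold Rdiv; rewrite Rabs_mult, (Rabs_pos_eq (/ x)); [lra |].
  apply Rlt_le, Rinv_0_lt_compat; lra. }
assert (Ev : Rbar_locally' p_infty (fun x => A <= x /\ 0 < x /\ 0 < T x)).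
{ apply is_lim_spec in LT; destruct (LT 0) as [B HB].
  exists (Rmax A (Rmax B 0)); intros x Hx.
  pose proof (Rmax_l A (Rmax B 0)); pose proof (Rmax_r A (Rmax B 0)).
  pose proof (Rmax_l B 0); pose proof (Rmax_r B 0).
  repeat split; [lra | lra | apply HB; lra]. }
assert (Leta1 : is_lim (fun x => T'' x / T' x - 4) p_infty 0).
{ apply (is_lim_ext_loc (fun x => h x * (1 / x) + - k / x)).
  - revert Ev; apply filter_imp; intros x [HA [Hx _]]; specialize (Tpos x HA).
    unfold h; field; lra.
  - rewrite <- (Rplus_0_r 0); apply is_lim_plus'; [| apply Linv].
    replace (Finite 0) with (Rbar_mult 0 0) by (simpl; f_equal; ring).
    apply is_lim_mult; [exact L2 | apply Linv | exact I]. }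
assert (L1 : is_lim (fun x => (T' x - 4 * T x) / T x) p_infty 0).
{ apply (little_o_of_derive (fun x => T' x - 4 * T x) T T' (fun x => T'' x / T' x - 4) A);
    try assumption; intros x Hx; specialize (Tpos x Hx); [| lra].
  evar_last.
  { apply (is_derive_minus (V := R_NormedModule)); [apply HT', Hx | apply is_derive_scal, HT, Hx]. }
  unfold minus, opp, plus; simpl; field; lra. }
assert (L1' : is_lim (fun x => T' x / T x) p_infty 4).
{ apply (is_lim_ext_loc (fun x => (T' x - 4 * T x) / T x + 4)).
  - revert Ev; apply filter_imp; intros x [_ [_ Hx]]; field; lra.
  - evar_last; [apply is_lim_plus'; [exact L1 | apply is_lim_const] |]; f_equal; ring. }
assert (L3 : is_lim (fun x => 4 * (T x / T' x)) p_infty 1).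
{ apply (is_lim_ext_loc (fun x => 4 * (/ (T' x / T x)))).
  - revert Ev; apply filter_imp; intros x [HA [_ Hx]]; specialize (Tpos x HA); field; lra.
  - evar_last; [apply is_lim_scal_l, is_lim_inv; [exact L1' |] |].
    + intros H; injection H; lra.
    + simpl; f_equal; field. }
apply (is_lim_ext_loc (fun x => (x * T' x - (4 * x - k) * T x) / T x)).
{ revert Ev; apply filter_imp; intros x [_ [_ Hx]]; field; lra. }
apply (little_o_of_derive (fun x => x * T' x - (4 * x - k) * T x) T T'
  (fun x => h x + (1 + (-1) * (4 * (T x / T' x)))) A); try assumption.
- intros x Hx; specialize (Tpos x Hx); evar_last.
  { apply (is_derive_minus (V := R_NormedModule)).
    - apply (is_derive_mult (fun x => x) T');
        [apply (is_derive_id (K := R_AbsRing)) | apply HT', Hx | exact Rmult_comm].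
    - apply (is_derive_mult (fun x => 4 * x - k) T); [| apply HT, Hx | exact Rmult_comm].
      evar_last; [auto_derive; [trivial |] |]; reflexivity. }
  unfold h, minus, opp, plus, mult, one; simpl; field; lra.
- intros x Hx; apply Rlt_le, Tpos, Hx.
- evar_last.
  { apply is_lim_plus'; [exact L2 | apply is_lim_plus'; [apply is_lim_const |]].
    apply (is_lim_scal_l (fun x => 4 * (T x / T' x)) (-1) p_infty 1), L3. }
  simpl; f_equal; ring.
Qed.

Lemma pq_lim eps : eps = 1 \/ eps = -1 -> is_lim (pq eps) p_infty p_infty.
Proof.
intros He; apply is_lim_spec; intros M.
exists (Rmax 7 M); intros x Hx.
pose proof (Rmax_l 7 M); pose proof (Rmax_r 7 M).
assert (Hx0 : 0 <= x) by lra.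
pose proof (pq_ge eps x He Hx0).
assert (x * 48 <= x ^ 3) by (simpl; nra).
lra.
Qed.

Definition pq'' (eps a : R) : R :=
  2 * (bI 0 a - eps * bI 1 a) * (2 * bI 1 a - eps * (2 * bI 0 a - bI 1 a / a)).

Lemma pq'_derive eps x : 0 < x ->
  is_derive (fun a => (bI 0 a - eps * bI 1 a) ^ 2) x (pq'' eps x).
Proof.
intros Hx; evar_last.
{ apply is_derive_pow, (is_derive_minus (V := R_NormedModule));
    [apply bI_0_derive | apply is_derive_scal, bI_1_derive', Hx]. }
unfold pq'', minus, opp, plus; simpl; ring.
Qed.

Lemma pq_log_derivative eps k : eps = 1 \/ eps = -1 ->
  is_lim (fun x => x * pq'' eps x / (bI 0 x - eps * bI 1 x) ^ 2 - 4 * x + k) p_infty 0 ->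
  is_lim (fun x => x * (bI 0 x - eps * bI 1 x) ^ 2 / pq eps x - 4 * x + k) p_infty 0.
Proof.
intros He L; destruct (sign_square_abs eps He) as [He2 _].
apply (log_derivative_asymptotics (pq eps) (fun x => (bI 0 x - eps * bI 1 x) ^ 2)
         (pq'' eps) 1); try assumption.
- intros x _; apply pq_derive, He2.
- intros x Hx; apply pq'_derive; lra.
- intros x Hx; apply pow_lt; pose proof (bI_sub_ge eps x He); lra.
- apply pq_lim, He.
Qed.

Lemma pq_minus_asymptotics :
  is_lim (fun x => x * (bI 0 x - 1 * bI 1 x) ^ 2 / pq 1 x - 4 * x + 3) p_infty 0.
Proof.
apply pq_log_derivative; [tauto |].
destruct bI_ratio_asymptotics as [C [HC0 HC]].
apply is_lim_0_of_bound with (2 * C) 2; intros x Hx.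
pose proof (bI_0_minus_1_gt x).
replace (_ + _) with (2 * (bI 0 x / (bI 0 x - bI 1 x) - (4 * x - / 2)))
  by (unfold pq''; field; lra).
specialize (HC x Hx); rewrite Rabs_mult, (Rabs_pos_eq 2) by lra.
unfold Rdiv in *; lra.
Qed.

Lemma pq_plus_asymptotics :
  is_lim (fun x => x * (bI 0 x - -1 * bI 1 x) ^ 2 / pq (-1) x - 4 * x + 1) p_infty 0.
Proof.
apply pq_log_derivative; [tauto |].
destruct bI_ratio_asymptotics as [C [HC0 HC]].
apply is_lim_0_of_bound with 1 (C + 2); intros x Hx.
assert (Hx2 : 2 <= x) by lra.
pose proof (bI_0_minus_1_gt x) as Hgap; pose proof (bI_1_ge_0 x) as H1.
assert (He : 0 < bI 0 x - bI 1 x) by lra.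
replace (_ + _) with ((bI 0 x - bI 1 x) / (bI 0 x + bI 1 x))
  by (unfold pq''; field; lra).
(* Once [x] exceeds [C + 2], the previous asymptotics give [I_0 >= x (I_0 - I_1)]. *)
specialize (HC x Hx2).
assert (C / x <= C).
{ apply Rmult_le_reg_r with x; [lra |]; unfold Rdiv; rewrite Rmult_assoc, Rinv_l by lra; nra. }
apply Rabs_le_between in HC.
assert (Hr : x <= bI 0 x / (bI 0 x - bI 1 x)) by lra.
apply Rmult_le_compat_r with (r := bI 0 x - bI 1 x) in Hr; [| lra].
unfold Rdiv in Hr at 1; rewrite Rmult_assoc, Rinv_l, Rmult_1_r in Hr by lra.
rewrite Rabs_pos_eq by (apply Rlt_le, Rdiv_lt_0_compat; lra).
apply Rmult_le_reg_r with (x * (bI 0 x + bI 1 x)); [apply Rmult_lt_0_compat; lra |].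
replace ((bI 0 x - bI 1 x) / (bI 0 x + bI 1 x) * (x * (bI 0 x + bI 1 x)))
  with (x * (bI 0 x - bI 1 x)) by (field; lra).
replace (1 / x * (x * (bI 0 x + bI 1 x))) with (bI 0 x + bI 1 x) by (field; lra).
lra.
Qed.

Theorem theorem28 :
  (forall a : R, 0 < a ->
     mu_diamond a = mu a + a * Derive (fun t => ln ((p t - q t) / (p t + q t))) a
     /\
     mu_diamond a =
       2 * a + a * Derive (fun t =>
         ln (((2 * t - 1) * BesselI 0 (2 * t) ^ 2
                - 2 * t * BesselI 1 (2 * t) ^ 2 + 1)
             / ((2 * t + 1) * BesselI 0 (2 * t) ^ 2
                - 2 * t * BesselI 1 (2 * t) ^ 2 - 1))) a)
  /\
  is_lim (fun a => mu_diamond a - (2 * a - 2)) p_infty 0.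
Proof.
split.
- intros a Ha; split; [apply mu_diamond_log_derivative, Ha |].
  rewrite mu_diamond_log_derivative by exact Ha.
  f_equal; f_equal; apply Derive_ext; intros t; f_equal.
  replace ((2 * t - 1) * BesselI 0 (2 * t) ^ 2 - 2 * t * BesselI 1 (2 * t) ^ 2 + 1)
    with (2 * (p t - q t)) by (unfold p, q; field).
  replace ((2 * t + 1) * BesselI 0 (2 * t) ^ 2 - 2 * t * BesselI 1 (2 * t) ^ 2 - 1)
    with (2 * (p t + q t)) by (unfold p, q; field).
  unfold Rdiv; rewrite Rinv_mult.
  transitivity ((2 * / 2) * ((p t - q t) * / (p t + q t))); [rewrite Rinv_r by lra |]; ring.
- apply (is_lim_ext_loc (fun x =>
    (x * (bI 0 x - 1 * bI 1 x) ^ 2 / pq 1 x - 4 * x + 3)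
    + (-1) * (x * (bI 0 x - -1 * bI 1 x) ^ 2 / pq (-1) x - 4 * x + 1))).
  + exists 0; intros x Hx; rewrite mu_diamond_closed_form by exact Hx.
    pose proof (pq_pos 1 x (or_introl eq_refl) Hx) as H1.
    pose proof (pq_pos (-1) x (or_intror eq_refl) Hx) as H2.
    unfold pq in *; field; lra.
  + evar_last.
    { apply is_lim_plus'; [exact pq_minus_asymptotics |].
      apply (is_lim_scal_l _ (-1) p_infty 0), pq_plus_asymptotics. }
    simpl; f_equal; ring.
Qed.
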